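(* Let $n\ge0$ and let $\sigma,\tau\in\mathrm{Typ}(n)$ be types of $n$. The coefficient of $P_\tau$ in the expansion of $E^+_\sigma$ in the basis $\{P_\rho:\rho\in\mathrm{Typ}(n)\}$ is $$\sum_{T\in \mathcal{PT}^{\mathrm{odoub}}(\sigma, \tau)} \frac{(-1)^{\ell_2(T)}}{z_{\tau}^\otimes}.$$
   Context: A type of $n$ is a sequence $\tau=(\tau|^1,\tau|^2,\dots)$ of (possibly empty) integer partitions with $\sum_{i\ge1} i\,|\tau|^i|=n$, where $|\tau|^i|$ is the size of the partition $\tau|^i$; $\mathrm{Typ}(n)$ is the set of types of $n$. Each part $d$ of $\tau|^r$ gives a block $d^r$ of $\tau$ (degree $d$, multiplicity $r$; not exponentiation). We list the blocks as $\tau=d_1^{r_1}d_2^{r_2}\cdots d_s^{r_s}$ with $r_1\le\cdots\le r_s$, blocks of equal multiplicity $r$ being listed in the (weakly decreasing) order of the parts of $\tau|^r$. For a partition $\lambda$, $z_\lambda=\prod_{i\ge1} i^{m_i(\lambda)}m_i(\lambda)!$, where $m_i(\lambda)$ is the number of parts of $\lambda$ equal to $i$. For a type $\tau$, $z_\tau^\otimes=\prod_{i\ge1} z_{\tau|^i}$. Let $x_{i,j}$ ($i,j\ge 1$) be indeterminates with $\deg x_{i,j}=i$; all series have rational coefficients. A monomial is square-free if every exponent is at most $1$. $E^+_d$ is the sum of all square-free monomials of degree $d$; for $d\ge1$, $P_d=\sum_{k\mid d}\sum_{j\ge1}k\,x_{k,j}^{d/k}$. For $F\in\{E^+,P\}$,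 $F_{d^r}$ is obtained from $F_d$ by replacing each $x_{i,j}$ by $x_{i,j}^r$, and $F_\tau=\prod F_{d^r}$ over all blocks $d^r$ of $\tau$ (counted with repetition; empty product $=1$). It is known that $\{F_\tau\}_{\tau\in\mathrm{Typ}(n)}$ is, for each such $F$, a $\mathbb{Q}$-basis of the space $\mathrm{PSym}(n)$ of polysymmetric functions of degree $n$ (power series homogeneous of degree $n$ that are symmetric separately in each variable set $\{x_{i,j}\}_{j\ge1}$). The diagram of a partition $\lambda$ has left-justified rows of $\lambda_1,\lambda_2,\dots$ cells; the tensor diagram of $\sigma$ is the sequence of diagrams of $\sigma|^1,\sigma|^2,\dots$, the $i$th one being called the $i$th tensor factor. A brick is a nonempty set of consecutive cells in one row; its length is its number of cells. A doublebrick is a brick of even length marked with a $+$ sign (and is distinguished from unmarked bricks, simply called bricks). An ordered double polybrick tabloid of shape $\sigma$ and content $\tau=d_1^{r_1}\cdots d_s^{r_s}$ is a decomposition of the tensor diagram of $\sigma$ into $s$ disjoint bricks and doublebricks, labeled bijectively by $1,\dots,s$, such that for each $1\le i\le s$ the object labeled $i$ is either a brick of length $d_i$ in the $r_i$th tensor factor, or (possible only if $r_i$ is even) a doublebrick of length $2d_i$ in the $(r_i/2)$th tensor factor, and the labels increase from left to right within each row. $\mathcal{PT}^{\mathrm{odoub}}(\sigma,\tau)$ is the set of these. For such $T$, $\ell_2(T)$ is the number of doublebricks in $T$. *)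

(* Defs.v *)
From HB Require Import structures.
From mathcomp Require Import all_boot all_order all_algebra finmap.
From mathcomp Require Import multiset boolp classical_sets fsbigop.

Set Implicit Arguments.
Unset Strict Implicit.
Unset Printing Implicit Defensive.

Import GRing.Theory Num.Theory.

Local Open Scope nat_scope.

Definition is_part (l : seq nat) : bool := sorted geq l && (0 \notin l).

(* Raw data for a type of [n]: entry [i] of the tuple is the partition with
   multiplicity [i].  In a type of [n], every part and every number of parts is
   at most [n] and only the multiplicities [1 .. n] occur, so the bounds lose
   nothing; they make [typ n] a [finType].  Entry [0] is a dummy that [is_typ]
   forces to be empty. *)
Definition pretyp (n : nat) := n.+1.-tuple (n.-bseq 'I_n.+1).

(* The partition tau|^i; if [t] is a type, it is empty for [i = 0] and [n < i]. *)
Definition tpart n (t : pretyp n) (i : nat) : seq nat :=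
  [seq val d | d <- nth [bseq] t i].

Definition is_typ n (t : pretyp n) : bool :=
  [&& all (fun i => is_part (tpart t i)) (iota 1 n),
      tpart t 0 == [::]
    & \sum_(1 <= i < n.+1) i * sumn (tpart t i) == n].

Record typ (n : nat) := Typ {typ_val :> pretyp n; _ : is_typ typ_val}.
HB.instance Definition _ n := [isSub for @typ_val n].
HB.instance Definition _ n := [Finite of typ n by <:].

(* The blocks d^r, as pairs [(d, r)], by weakly increasing [r] and, for equal
   [r], in the order of the parts of tau|^r. *)
Definition blocks n (t : typ n) : seq (nat * nat) :=
  [seq (d, r) | r <- iota 1 n, d <- tpart t r].

Definition zpart (l : seq nat) : nat :=
  \prod_(1 <= i < (sumn l).+1) (i ^ count_mem i l * (count_mem i l)`!).

Definition ztensor n (t : typ n) : nat :=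
  \prod_(1 <= i < n.+1) zpart (tpart t i).

(* The pair [(i, j) : var] stands for the indeterminate x_{i+1,j+1}. *)
Definition var := (nat * nat)%type.
Definition vdeg (v : var) : nat := v.1.+1.

(* A monomial is the finite multiset of its variables; [m v] is the exponent of
   [v] in [m]. *)
Definition monom := {mset var}%mset.

Definition mdeg (m : monom) : nat := \sum_(v <- finsupp m) vdeg v * m v.

Definition squarefree (m : monom) : bool := all (fun v => m v <= 1) (finsupp m).

Local Open Scope ring_scope.

(* A power series, given by its coefficients. *)
Definition pseries : Type := monom -> rat.

Definition pone : pseries := fun m => (m == mset0)%:R.

(* In the next three definitions [\sum_(_ \in A)] is the sum of a finitely
   supported family.  The sums are indeed finite: a monomial has finitely many
   factorizations, at most one r-th root (0 < r), and, for given [d] and [k],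
   is the power x_{k,j}^(d/k) for at most one [j] (0 < d). *)
Definition pmul (f g : pseries) : pseries := fun m =>
  \sum_(p \in [set p : monom * monom | forall v, m v = (p.1 v + p.2 v)%N]%classic)
     f p.1 * g p.2.

(* [f] with every variable replaced by its [r]-th power. *)
Definition psubst (r : nat) (f : pseries) : pseries := fun m =>
  \sum_(m' \in [set m' : monom | forall v, m v = (r * m' v)%N]%classic) f m'.

Definition Pd (d : nat) : pseries := fun m =>
  \sum_(k <- divisors d) \sum_(j \in [set: nat]%classic)
     (k%:R * (m == msetn (d %/ k)%N (k.-1, j))%:R : rat).

Definition Eplusd (d : nat) : pseries := fun m =>
  (squarefree m && (mdeg m == d))%:R.

(* F_tau, the product of the F_{d^r} over the blocks d^r of tau. *)
Definition ptyp (F : nat -> pseries) n (t : typ n) : pseries :=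
  \big[pmul/pone]_(b <- blocks t) psubst b.2 (F b.1).

(* [c] is a family of coordinates of [f] on the F_rho, rho in Typ(n). *)
Definition expands n (f : pseries) (F : nat -> pseries) (c : typ n -> rat) : Prop :=
  forall m : monom, f m = \sum_(rho : typ n) c rho * ptyp F rho m.

(* The cell [(i, a, b)] is in tensor factor [i], row [a], column [b], rows and
   columns being counted from 0.  The bounds lose nothing, as for [pretyp]. *)
Definition cell (n : nat) := ('I_n.+1 * 'I_n * 'I_n)%type.

Definition tdiagram n (t : typ n) : {set cell n} :=
  [set x : cell n | (x.2 < nth 0%N (tpart t x.1.1) x.1.2)%N]%SET.

Definition is_brick n (B : {set cell n}) : bool :=
  (B != finset.set0) &&
  [forall x in B, forall y in B, (x.1 == y.1) &&
    [forall z : cell n, (z.1 == x.1) && (x.2 <= z.2 <= y.2)%N ==> (z \in B)]].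

Definition in_factor n (B : {set cell n}) (i : nat) : bool :=
  [forall x in B, x.1.1 == i :> nat].

Definition label n (tau : typ n) := 'I_(size (blocks tau)).

(* Possible labeled objects: entry [i] is the object labeled [i] (labels start
   at 0), made of its set of cells and of a boolean telling whether it is a
   doublebrick. *)
Definition pretabloid n (tau : typ n) :=
  {ffun label tau -> {set cell n} * bool}.

Definition object_ok n (d r : nat) (o : {set cell n} * bool) : bool :=
  is_brick o.1 &&
  (if o.2 then [&& ~~ odd r, #|o.1| == (2 * d)%N & in_factor o.1 r./2]
   else (#|o.1| == d) && in_factor o.1 r).

Definition is_odoub n (sigma tau : typ n) (T : pretabloid tau) : bool :=
  [&& [forall i : label tau,
        let b := nth (0, 0)%N (blocks tau) i in object_ok b.1 b.2 (T i)],
      [forall i : label tau, forall j : label tau,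
        (i != j) ==> [disjoint (T i).1 & (T j).1]],
      (\bigcup_i (T i).1)%SET == tdiagram sigma
    & [forall i : label tau, forall j : label tau,
        forall x in (T i).1, forall y in (T j).1,
        (x.1 == y.1) && (x.2 < y.2)%N ==> (i <= j)%N]].

Definition PTodoub n (sigma tau : typ n) : {set pretabloid tau} :=
  [set T | is_odoub sigma T]%SET.

Definition ell2 n (tau : typ n) (T : pretabloid tau) : nat := #|[set i | (T i).2]%SET|.

(* Main.v *)
Require Import Defs.
From HB Require Import structures.
From mathcomp Require Import all_boot all_order all_algebra.
From mathcomp Require Import fingroup perm.
From mathcomp Require Import finmap multiset boolp classical_sets cardinality fsbigop.
From mathcomp Require Import zify ring.

(* Taking logarithms in [sum_d E+_d t^d = prod_(i,j) (1 + x_(i,j) t^i)], with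
   [1 + y = (1 - y^2) / (1 - y)], gives
     [sum_d E+_d t^d = exp (sum_d P_d t^d / d - sum_d P_(d^2) t^(2d) / d)],
   equivalently [d E+_d = sum_a P_a E+_(d-a) - 2 sum_a P_(a^2) E+_(d-2a)].
   Hence E+_sigma, as a function of the vector of row lengths of sigma, is the
   sum over s of 1/s! times the sum over all words of s letters, a letter being
   the choice of a row and of a brick or doublebrick in it, whose lengths add
   up to the row lengths: both sides satisfy the same recursion.  Grouping the
   words by the multiset of their blocks replaces 1/s! by 1/z_tau and the words
   by assignments of the labeled blocks of tau to rows; since labels increase
   along a row, such an assignment is the same thing as a tabloid.
   The P_rho are linearly independent: in P_rho, the coefficient of the monomial
   of rho', the product of x_(d,i)^r over the blocks d^r of rho' with distinct
   second indices i, vanishes unless the degrees of the blocks of rho add up to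
   at least those of rho', with equality only for rho = rho'. *)

Set Implicit Arguments.
Unset Strict Implicit.
Unset Printing Implicit Defensive.
Import Order.TTheory GRing.Theory Num.Theory.
Local Open Scope mset_scope.
Local Open Scope ring_scope.

(** * Power series *)

Definition submon (m : monom) : {fset monom} :=
  fset_set [set a : monom | msubset a m]%classic.

(** A divisor of [m] is determined by its exponents on the support of [m], and these are at most the
    sum of all exponents of [m]; only finitely many exponent functions qualify. *)
Lemma finite_submon (m : monom) : finite_set [set a : monom | msubset a m]%classic.
Proof.
pose N := (\sum_(v <- finsupp m) m v).+1.
pose h (f : {ffun finsupp m -> 'I_N}) : monom := [fsfun v : finsupp m => val (f v)].
apply: (@sub_finite_set _ _ (range h)); last exact: finite_image (@finite_finset _ _).
move=> a /= /msubsetP am.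
have lt v : v \in finsupp m -> (a v < N)%N.
  move=> vm; rewrite ltnS (leq_trans (am v)) //.
  by rewrite (big_fsetD1 v) //= leq_addr.
exists [ffun v => inord (a (val v))] => //.
apply/fsfunP => v; rewrite fsfun_ffun.
case: insubP => [u um uv|vm].
  by rewrite /= ffunE uv inordK // lt.
apply/esym/eqP; rewrite -leqn0 (leq_trans (am v)) // leqn0.
by rewrite -memNfinsupp.
Qed.

Lemma mem_submon (m a : monom) : (a \in submon m) = msubset a m.
Proof.
by rewrite in_fset_set ?asboolE; [apply/idP/idP; rewrite inE | exact: finite_submon].
Qed.

Lemma pmulE (f g : pseries) m :
  pmul f g m = \sum_(a <- submon m) f a * g (m `\` a).
Proof.
rewrite /pmul (reindex_fsbig (fun a : monom => (a, m `\` a)) [set a : monom | msubset a m]%classic).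
  by rewrite fsbig_finite //=; exact: finite_submon.
split.
- move=> a /= /msubsetP am v; rewrite msetE2 subnKC //; exact: am.
- by move=> a b _ _ [].
- move=> [a b] /= E; exists a => /=.
    by apply/msubsetP => v; rewrite E leq_addr.
  by congr pair; apply/msetP => v; rewrite msetE2 E addKn.
Qed.

Lemma submon_uniq m : uniq (submon m).
Proof. exact: fset_uniq. Qed.

Lemma perm_submon_sub m : perm_eq (submon m) [seq m `\` a | a <- submon m].
Proof.
have sub a : a \in submon m -> m `\` a \in submon m.
  by move=> _; rewrite mem_submon; apply/msubsetP => v; rewrite msetE2 leq_subr.
apply: uniq_perm; first exact: submon_uniq.
  rewrite map_inj_in_uniq ?submon_uniq // => a b; rewrite !mem_submon => am bm E.
  by rewrite -(msetBBK am) E msetBBK.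
move=> a; apply/idP/mapP => [am|[b bm ->]]; last exact: sub.
exists (m `\` a); first exact: sub.
by rewrite msetBBK // -mem_submon.
Qed.

Lemma perm_submon_above c m : msubset c m ->
  perm_eq [seq a <- submon m | msubset c a] [seq c `+` d | d <- submon (m `\` c)].
Proof.
move=> cm; apply: uniq_perm; first by rewrite filter_uniq ?submon_uniq.
  by rewrite map_inj_uniq ?submon_uniq // => a b /(congr1 (msetB^~ c)); rewrite !msetDKB.
move=> a; rewrite mem_filter mem_submon; apply/andP/mapP => [[/msubsetP ca /msubsetP am]|].
  exists (a `\` c); last by rewrite msetBDKC //; apply/msubsetP.
  rewrite mem_submon; apply/msubsetP => v; rewrite !msetE2 leq_sub2r //; exact: am.
case=> d; rewrite mem_submon => /msubsetP dm ->; split; apply/msubsetP => v; rewrite msetE2 ?leq_addr //.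
by move: (dm v); rewrite msetE2 => h; rewrite -(subnKC ((msubsetP cm) v)) leq_add2l.
Qed.

(** Both sides run over the ordered factorizations of [m] into three monomials, grouped by the
    product of the first two on the left and by the first one on the right; this gives associativity
    of [pmul]. *)
Lemma sum_submonA (V : nmodType) (G : monom -> monom -> monom -> V) m :
  \sum_(a <- submon m) \sum_(c <- submon a) G c (a `\` c) (m `\` a) =
  \sum_(c <- submon m) \sum_(d <- submon (m `\` c)) G c d ((m `\` c) `\` d).
Proof.
have inner a : a \in submon m -> \sum_(c <- submon a) G c (a `\` c) (m `\` a) =
    \sum_(c <- submon m | msubset c a) G c (a `\` c) (m `\` a).
  rewrite mem_submon => am; rewrite -[RHS]big_filter; apply: perm_big; apply: uniq_perm.
  - exact: submon_uniq.
  - by rewrite filter_uniq ?submon_uniq.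
  move=> c; rewrite mem_filter !mem_submon; case: (boolP (msubset c a)) => //= ca.
  by rewrite (msubset_trans ca am).
rewrite big_seq (eq_bigr _ inner) -big_seq (exchange_big_dep predT) //=.
rewrite big_seq [RHS]big_seq; apply: eq_bigr => c; rewrite mem_submon => cm.
rewrite -big_filter (perm_big _ (perm_submon_above cm)) big_map.
by apply: eq_bigr => d _; rewrite msetDKB msetBDA.
Qed.

(** * The commutative algebra of power series over the rationals *)

HB.instance Definition _ := gen_eqMixin pseries.
HB.instance Definition _ := gen_choiceMixin pseries.

Definition padd (f g : pseries) : pseries := fun m => f m + g m.
Definition popp (f : pseries) : pseries := fun m => - f m.
Definition pzero : pseries := fun=> 0.
Definition pscale (q : rat) (f : pseries) : pseries := fun m => q * f m.

Fact paddA : associative padd.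
Proof. by move=> f g h; apply/funext => m; exact: addrA. Qed.
Fact paddC : commutative padd.
Proof. by move=> f g; apply/funext => m; exact: addrC. Qed.
Fact padd0 : left_id pzero padd.
Proof. by move=> f; apply/funext => m; exact: add0r. Qed.
Fact paddN : left_inverse pzero popp padd.
Proof. by move=> f; apply/funext => m; exact: addNr. Qed.

HB.instance Definition _ := GRing.isZmodule.Build pseries paddA paddC padd0 paddN.

Fact pmulA : associative pmul.
Proof.
move=> f g h; apply/funext => m; rewrite !pmulE.
under eq_bigr do rewrite pmulE big_distrr /=.
under [RHS]eq_bigr do rewrite pmulE big_distrl /=.
rewrite (sum_submonA (fun x y z => f x * g y * h z)).
by apply: eq_bigr => a _; apply: eq_bigr => b _; rewrite mulrA.
Qed.

Fact pmulC : commutative pmul.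
Proof.
move=> f g; apply/funext => m; rewrite !pmulE (perm_big _ (perm_submon_sub m)) big_map.
rewrite big_seq [RHS]big_seq; apply: eq_bigr => a; rewrite mem_submon => am.
by rewrite msetBBK // mulrC.
Qed.

Fact pmul1 : left_id pone pmul.
Proof.
move=> f; apply/funext => m; rewrite pmulE (big_fsetD1 mset0) /=; last by rewrite mem_submon msub0set.
rewrite /pone eqxx mul1r big_seq big1 ?addr0; last first.
  by move=> a; rewrite in_fsetD1 => /andP[/negPf -> _]; rewrite mul0r.
by congr f; apply/msetP => v; rewrite msetE2 mset0E subn0.
Qed.

Fact pmulDl : left_distributive pmul padd.
Proof.
move=> f g h; apply/funext => m; rewrite /padd !pmulE -big_split /=.
by apply: eq_bigr => a _; rewrite mulrDl.
Qed.

Fact pone_neq0 : pone != pzero.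
Proof. by apply/eqP => /(congr1 (fun f : pseries => f mset0)); rewrite /pone eqxx. Qed.

HB.instance Definition _ :=
  GRing.Zmodule_isComNzRing.Build pseries pmulA pmulC pmul1 pmulDl pone_neq0.

Lemma coefMp (f g : pseries) m :
  (f * g) m = \sum_(a <- submon m) f a * g (m `\` a).
Proof. exact: pmulE. Qed.

Lemma coefMp_neq0 (f g : pseries) m : (f * g) m != 0 ->
  exists a, [/\ msubset a m, f a != 0 & g (m `\` a) != 0].
Proof.
rewrite coefMp => nz; apply: contrapT => no; case/eqP: nz.
rewrite big_seq big1 // => a; rewrite mem_submon => am; apply/eqP; rewrite mulf_eq0.
apply: contrapT => /negP; rewrite negb_or => /andP[fa ga]; apply: no.
by exists a.
Qed.

Fact pscaleA a b f : pscale a (pscale b f) = pscale (a * b) f.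
Proof. by apply/funext => m; exact: mulrA. Qed.
Fact pscale1 : left_id 1 pscale.
Proof. by move=> f; apply/funext => m; exact: mul1r. Qed.
Fact pscaleDr : right_distributive pscale +%R.
Proof. by move=> a f g; apply/funext => m; exact: mulrDr. Qed.
Fact pscaleDl f : {morph pscale^~ f : a b / a + b}.
Proof. by move=> a b; apply/funext => m; exact: mulrDl. Qed.

HB.instance Definition _ :=
  GRing.Zmodule_isLmodule.Build rat pseries pscaleA pscale1 pscaleDr pscaleDl.

Fact pscaleAl (a : rat) (f g : pseries) : a *: (f * g) = (a *: f) * g.
Proof.
apply/funext => m; change (a * (f * g) m = (pscale a f * g) m).
rewrite !coefMp big_distrr /=.
by apply: eq_bigr => b _; rewrite mulrA.
Qed.

HB.instance Definition _ := GRing.Lmodule_isLalgebra.Build rat pseries pscaleAl.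
HB.instance Definition _ := GRing.Lalgebra_isComAlgebra.Build rat pseries.

Lemma coefDp (f g : pseries) m : (f + g) m = f m + g m.
Proof. by []. Qed.

Lemma coefNp (f : pseries) m : (- f) m = - f m.
Proof. by []. Qed.

Lemma coefZp q (f : pseries) m : (q *: f) m = q * f m.
Proof. by []. Qed.

Lemma coef_sump I (r : seq I) P (F : I -> pseries) m :
  (\sum_(i <- r | P i) F i) m = \sum_(i <- r | P i) F i m.
Proof. by elim/big_rec2: _ => // i x y _ <-. Qed.

Lemma ptypE F n (t : typ n) : ptyp F t = \prod_(b <- blocks t) psubst b.2 (F b.1) :> pseries.
Proof. by []. Qed.

Lemma sum_uniq_supp (V : nmodType) (T : eqType) (s1 s2 : seq T) (F : T -> V) :
  uniq s1 -> uniq s2 -> {subset s2 <= s1} ->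
  (forall x, x \in s1 -> x \notin s2 -> F x = 0) ->
  \sum_(x <- s1) F x = \sum_(x <- s2) F x.
Proof.
move=> u1 u2 sub F0; rewrite (bigID (mem s2)) /= [X in _ + X]big_seq_cond.
rewrite [X in _ + X]big1 ?addr0; last by move=> x /andP[]; exact: F0.
rewrite -big_filter; apply: perm_big; apply: uniq_perm => // [|x].
  exact: filter_uniq.
by rewrite mem_filter /=; case: (boolP (x \in s2)) => //= /sub.
Qed.

(** * Substitution of r-th powers for the variables *)

Definition mscale r (m : monom) : monom := iter r (msetD m) mset0.

Lemma mscaleE r m v : mscale r m v = (r * m v)%N.
Proof. by elim: r => [|r IH]; rewrite ?mset0E //= msetE2 IH mulSn. Qed.

Lemma mscaleA r s m : mscale r (mscale s m) = mscale (r * s) m.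
Proof. by apply/msetP => v; rewrite !mscaleE mulnA. Qed.

Lemma mscale_inj r : (0 < r)%N -> injective (mscale r).
Proof.
move=> r0 a b /msetP E; apply/msetP => v; have := E v; rewrite !mscaleE.
by move/eqP; rewrite eqn_pmul2l // => /eqP.
Qed.

Lemma mscale_msetn r c v : mscale r (msetn c v) = msetn (r * c) v.
Proof. by apply/msetP => w; rewrite mscaleE !msetnE; case: eqP; rewrite ?muln0. Qed.

Lemma psubst_mscale r f m : (0 < r)%N -> psubst r f (mscale r m) = f m.
Proof.
move=> r0; rewrite /psubst.
have -> : [set a : monom | forall v, mscale r m v = (r * a v)%N]%classic = [set m]%classic.
  apply/seteqP; split => [a E | a -> v]; last by rewrite mscaleE.
  by apply: (mscale_inj r0); apply/msetP => v; rewrite E mscaleE.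
exact: fsbig_set1.
Qed.

Lemma psubst_neq0 r f m : (0 < r)%N -> psubst r f m != 0 ->
  exists a, m = mscale r a.
Proof.
move=> r0 nz; apply: contrapT => no.
case/eqP: nz; rewrite /psubst.
have -> : [set a : monom | forall v, m v = (r * a v)%N]%classic = set0; last exact: fsbig_set0.
rewrite -subset0 => a E; apply: no; exists a.
by apply/msetP => v; rewrite mscaleE.
Qed.

(** For positive [r], a series supported on r-th powers of monomials is determined by its
    coefficients there. This replaces the defining sum of [psubst] in the proofs that substitutions
    compose and respect the algebra operations. *)
Lemma psubst_eqP r (f : pseries) (g : pseries) : (0 < r)%N ->
  (forall m, g (mscale r m) = f m) ->
  (forall m, g m != 0 -> exists a, m = mscale r a) -> psubst r f = g.
Proof.
move=> r0 E1 E2; apply/funext => m.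
have [[a ->]|no] := pselect (exists a, m = mscale r a); first by rewrite E1 psubst_mscale.
have [->|/E2 //] := eqVneq (g m) 0.
by have [//|/(psubst_neq0 r0)] := eqVneq (psubst r f m) 0.
Qed.

Lemma psubstA r s (f : pseries) : (0 < r)%N -> (0 < s)%N ->
  psubst r (psubst s f) = psubst (r * s) f.
Proof.
move=> r0 s0; apply/esym/psubst_eqP => [|m|m nz]; first by rewrite muln_gt0 r0.
  by rewrite -mscaleA !psubst_mscale.
have [a Ea] := psubst_neq0 r0 nz; move: nz; rewrite Ea psubst_mscale //.
by case/(psubst_neq0 s0) => b ->; exists b; rewrite mscaleA.
Qed.

Lemma psubstD r (f g : pseries) : (0 < r)%N -> psubst r (f + g) = psubst r f + psubst r g.
Proof.
move=> r0; apply: psubst_eqP => // m; rewrite coefDp.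
  by rewrite !psubst_mscale.
have [->|/(psubst_neq0 r0) //] := eqVneq (psubst r f m) 0.
by rewrite add0r => /(psubst_neq0 r0).
Qed.

Lemma psubstZ r q (f : pseries) : (0 < r)%N -> psubst r (q *: f) = q *: psubst r f.
Proof.
move=> r0; apply: psubst_eqP => // m; rewrite coefZp.
  by rewrite psubst_mscale.
by rewrite mulf_eq0 => /norP[_ /(psubst_neq0 r0)].
Qed.

Lemma psubst_sum r I (s : seq I) P (F : I -> pseries) : (0 < r)%N ->
  psubst r (\sum_(i <- s | P i) F i) = \sum_(i <- s | P i) psubst r (F i).
Proof.
move=> r0; apply: (big_morph (psubst r) (id1 := 0)) => [f g|]; first exact: psubstD.
by rewrite -[in LHS](scale0r (0 : pseries)) psubstZ // scale0r.
Qed.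

Lemma psubst1 r : (0 < r)%N -> psubst r (1 : pseries) = 1.
Proof.
have m0 : mscale r mset0 = mset0 by apply/msetP => v; rewrite mscaleE !mset0E muln0.
move=> r0; apply: psubst_eqP => // m; rewrite /GRing.one /= /pone.
  by rewrite -{1}m0 (inj_eq (mscale_inj r0)).
by have [-> _|] := eqVneq m mset0; [exists mset0 | rewrite eqxx].
Qed.

Lemma psubstM r (f g : pseries) : (0 < r)%N -> psubst r (f * g) = psubst r f * psubst r g.
Proof.
move=> r0; apply: psubst_eqP => // m; last first.
  case/coefMp_neq0 => a [am /(psubst_neq0 r0)[a' Ea] /(psubst_neq0 r0)[b' Eb]].
  exists (a' `+` b'); rewrite -(msetBDKC am) Eb Ea.
  by apply/msetP => v; rewrite !(mscaleE, msetE2) mulnDr.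
(* Divisors of the r-th power of [m] that are not r-th powers contribute nothing; the others are the
   r-th powers of the divisors of [m]. *)
rewrite coefMp (@sum_uniq_supp _ _ _ [seq mscale r a | a <- submon m]) ?submon_uniq //.
- rewrite big_map coefMp; apply: eq_bigr => a _; rewrite psubst_mscale //; congr (_ * _).
  rewrite (_ : _ `\` _ = mscale r (m `\` a)) ?psubst_mscale //.
  by apply/msetP => v; rewrite !(mscaleE, msetE2) mulnBr.
- by rewrite map_inj_uniq ?submon_uniq //; exact: mscale_inj r0.
- move=> b /mapP[a]; rewrite !mem_submon => /msubsetP am ->; apply/msubsetP => v.
  by rewrite !mscaleE leq_mul2l (am v) orbT.
move=> a; rewrite mem_submon => /msubsetP am na.
have [->|/(psubst_neq0 r0)[b E]] := eqVneq (psubst r f a) 0; first by rewrite mul0r.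
case/mapP: na; exists b => //; rewrite mem_submon; apply/msubsetP => v.
by move: (am v); rewrite E !mscaleE leq_pmul2l.
Qed.

(** * Coefficients of P_d and the recursion for E+_d *)

Lemma vdeg_gt0 v : (0 < vdeg v)%N. Proof. by []. Qed.

Lemma fsbig_one (V : nmodType) (j0 : nat) (F : nat -> V) :
  (forall j, j != j0 -> F j = 0) -> \sum_(j \in [set: nat]%classic) F j = F j0.
Proof.
move=> F0; rewrite -(@fsbig_widen _ _ _ _ [set j0]%classic) ?fsbig_set1 //.
by move=> j /= [_ /eqP/F0].
Qed.

Lemma msetn_eq c d (v w : var) : (0 < c)%N -> (msetn c v == msetn d w) = (c == d) && (v == w).
Proof.
move=> c0; apply/eqP/andP => [/msetP E|[/eqP -> /eqP ->] //].
have := E v; rewrite msetnxx msetnE; case: (v =P w) => [_ ->|_ E0]; first by rewrite eqxx.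
by rewrite E0 in c0.
Qed.

(** The variable [v] fixes both [k], its degree, and [j], its second index, so at most one term of
    the double sum contributes. *)
Lemma Pd_msetn a c v : (0 < a)%N -> (0 < c)%N ->
  Pd a (msetn c v) = if (c * vdeg v == a)%N then (vdeg v)%:R else 0.
Proof.
move=> a0 c0; rewrite /Pd; case: v => i j0.
have inner k : \sum_(j \in [set: nat]%classic) (k%:R * (msetn c (i, j0) == msetn (a %/ k)%N (k.-1, j))%:R : rat) =
    if (c == a %/ k)%N && (i == k.-1) then k%:R else 0.
  rewrite (fsbig_one (j0 := j0)) => [|j jj0]; rewrite msetn_eq // xpair_eqE.
    by rewrite eqxx andbT; case: ifP; rewrite ?mulr1 ?mulr0.
  by rewrite (eq_sym j0) (negPf jj0) !andbF mulr0.
under eq_bigr do rewrite inner.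
rewrite /vdeg /=; case: eqP => [E|NE].
  have ia : (i.+1 \in divisors a)%N by rewrite -dvdn_divisors // -E dvdn_mull.
  rewrite (bigD1_seq i.+1) ?divisors_uniq //= -{1}E mulnK // !eqxx /=.
  rewrite big_seq_cond big1 ?addr0 // => k /andP[]; rewrite -dvdn_divisors // => ka kn.
  case: ifP => // /andP[_ /eqP ik]; case/eqP: kn; rewrite ik prednK //.
  exact: dvdn_gt0 ka.
rewrite big_seq big1 // => k; rewrite -dvdn_divisors // => ka; case: ifP => // /andP[/eqP ck /eqP ik].
by case: NE; rewrite ck ik prednK ?divnK // (dvdn_gt0 a0).
Qed.

Lemma Pd_neq0 a m : (0 < a)%N -> Pd a m != 0 ->
  exists v c, [/\ (0 < c)%N, m = msetn c v & (c * vdeg v = a)%N].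
Proof.
move=> a0 nz.
have [v [c [c0 E]]] : exists v c, (0 < c)%N /\ m = msetn c v.
  apply: contrapT => no; case/eqP: nz; rewrite /Pd big_seq big1 // => k; rewrite -dvdn_divisors // => ka.
  apply: fsbig1 => j _; case: eqP => [E|]; last by rewrite mulr0.
  case: no; exists (k.-1, j), (a %/ k)%N; split => //.
  by rewrite divn_gt0 ?(dvdn_gt0 a0) // dvdn_leq.
exists v, c; split => //; move: nz; rewrite E Pd_msetn //; case: ifP => [/eqP //|_].
by rewrite eqxx.
Qed.

Lemma psubst_Pd_msetn r a c v : (0 < r)%N -> (0 < a)%N -> (0 < c)%N ->
  psubst r (Pd a) (msetn c v) =
  if (r %| c)%N && (c * vdeg v == r * a)%N then (vdeg v)%:R else 0.
Proof.
move=> r0 a0 c0; have [/dvdnP[d Ed]|nd] := boolP (r %| c)%N => /=.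
  rewrite Ed mulnC -mscale_msetn psubst_mscale // -mulnA eqn_pmul2l // Pd_msetn //.
  by move: c0; rewrite Ed; case: (d).
have [//|/(psubst_neq0 r0)[b Eb]] := eqVneq (psubst r (Pd a) (msetn c v)) 0.
by move: nd; rewrite -(msetnxx c v) Eb mscaleE dvdn_mulr.
Qed.

Lemma psubst_Pd_neq0 r a m : (0 < r)%N -> (0 < a)%N -> psubst r (Pd a) m != 0 ->
  exists v c, [/\ (0 < c)%N, m = msetn (r * c) v & (c * vdeg v = a)%N].
Proof.
move=> r0 a0 nz; have [b Eb] := psubst_neq0 r0 nz.
move: nz; rewrite Eb psubst_mscale // => /(Pd_neq0 a0)[v [c [c0 -> cv]]].
by exists v, c; rewrite mscale_msetn.
Qed.

Lemma sum_submon_msetn (V : nmodType) (F : monom -> V) m :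
  (forall b, F b != 0 -> exists v c, (0 < c)%N /\ b = msetn c v) ->
  \sum_(b <- submon m) F b = \sum_(v <- finsupp m) \sum_(1 <= c < (m v).+1) F (msetn c v).
Proof.
move=> F0; transitivity (\sum_(b <- [seq msetn c v | v <- finsupp m, c <- index_iota 1 (m v).+1]) F b);
  last by rewrite big_allpairs_dep.
apply: sum_uniq_supp; first exact: submon_uniq.
- apply: allpairs_uniq_dep => //= [v _|]; first exact: iota_uniq.
  move=> [v c] [w d] /allpairsPdep[v' [c' [_ cI [-> ->]]]] _ /= /eqP.
  move: cI; rewrite mem_index_iota => /andP[c0 _].
  by rewrite msetn_eq // => /andP[/eqP -> /eqP ->].
- move=> b /allpairsPdep[v [c [_ cI ->]]]; rewrite mem_submon; apply/msubsetP => w.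
  by rewrite msetnE; case: eqP => // ->; move: cI; rewrite mem_index_iota ltnS => /andP[].
move=> b; rewrite mem_submon => /msubsetP bm nb.
have [//|/F0[v [c [c0 E]]]] := eqVneq (F b) 0.
have cv : (c <= m v)%N by have := bm v; rewrite E msetnxx.
case/allpairsPdep: nb; exists v, c; split => //; last by rewrite mem_index_iota ltnS c0.
by rewrite mem_finsupp -lt0n (leq_trans c0).
Qed.

Lemma mdegE (S : {fset var}) (m : monom) : {subset finsupp m <= S} ->
  mdeg m = (\sum_(v <- S) vdeg v * m v)%N.
Proof.
move=> sub; apply: big_fset_incl; first exact/fsubsetP.
by move=> v _; rewrite memNfinsupp => /eqP ->; rewrite muln0.
Qed.

Lemma mdegD (a b : monom) : mdeg (a `+` b) = (mdeg a + mdeg b)%N.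
Proof.
pose S := (finsupp a `|` finsupp b)%fset.
have sa : {subset finsupp a <= S} by move=> v; rewrite in_fsetU => ->.
have sb : {subset finsupp b <= S} by move=> v; rewrite in_fsetU orbC => ->.
have sab : {subset finsupp (a `+` b) <= S}.
  move=> v; rewrite in_fsetU !mem_finsupp msetE2 addn_eq0.
  by case: (a v == _) (b v == _) => [] [].
rewrite (mdegE sa) (mdegE sb) (mdegE sab) -big_split /=.
by apply: eq_bigr => v _; rewrite msetE2 mulnDr.
Qed.

Lemma mdeg_msetn c (v : var) : mdeg (msetn c v) = (c * vdeg v)%N.
Proof.
rewrite (@mdegE [fset v]%fset) ?big_seq_fset1 ?msetnxx 1?mulnC // => w.
by rewrite mem_finsupp msetnE in_fset1; case: (w == v).
Qed.

Lemma squarefreeP (m : monom) : reflect (forall v, (m v <= 1)%N) (squarefree m).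
Proof.
apply: (iffP allP) => [sf v|le v _]; last exact: le.
have [/sf //|] := boolP (v \in finsupp m); by rewrite memNfinsupp => /eqP ->.
Qed.

Lemma squarefree_msetB (m : monom) c v :
  squarefree (m `\` msetn c v) = (m v - c <= 1)%N && squarefree (m `\` msetn (m v) v).
Proof.
apply/squarefreeP/andP => [le|[le1 /squarefreeP le] w].
  split; first by have := le v; rewrite msetE2 msetnxx.
  apply/squarefreeP => w; have := le w; rewrite !msetE2 !msetnE.
  by case: eqP => // ->; rewrite subnn.
have := le w; rewrite !msetE2 !msetnE; case: eqP => // -> _; exact: le1.
Qed.

(** For y the variable [v], this reflects the identity (y - y^2 + y^3 - ...)(1 + y) = y. Only c =
    [m v] and c = [m v] - 1 leave [v] with exponent at most 1; their terms have opposite signs and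
    cancel, except when [m v] = 1, where the second is out of range. *)
Lemma sum_sign_squarefree (m : monom) v : v \in finsupp m ->
  \sum_(1 <= c < (m v).+1) (-1) ^+ c.+1 * (squarefree (m `\` msetn c v))%:R =
  (squarefree m)%:R :> rat.
Proof.
rewrite mem_finsupp -lt0n => mv.
have m0 : m `\` msetn 0 v = m by apply/msetP => w; rewrite msetE2 msetnE; case: eqP; rewrite subn0.
have sm := squarefree_msetB m 0 v; rewrite m0 subn0 in sm.
under eq_bigr do rewrite squarefree_msetB.
move: mv sm; case: (m v) => [//|[|e]] _ sm.
  by rewrite big_nat1 sm /= expr2 mulN1r opprK mul1r.
rewrite big_nat_recr //= big_nat_recr //= big_nat big1 ?add0r; last first.
  move=> c /andP[_ ce]; rewrite (_ : (e.+2 - c <= 1)%N = false) ?mulr0 //; lia.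
rewrite sm subnn (_ : (e.+2 - e.+1 <= 1)%N = true); last by lia.
by rewrite /= (exprS _ e.+2) mulN1r mulNr addrN.
Qed.

(** The support of [psubst r (Pd a)] consists of powers v^c with r | c and c deg(v) = r a. Thus v
    and c determine a, and the sum over a collapses to the condition r | c. *)
Lemma coef_Pd_Eplusd r d m : (0 < r)%N ->
  \sum_(1 <= a < d.+1 | (r * a <= d)%N)
    (psubst r (Pd a) * (Eplusd (d - r * a) : pseries)) m =
  \sum_(v <- finsupp m) \sum_(1 <= c < (m v).+1)
    (r %| c)%N%:R * (vdeg v)%:R * ((mdeg m == d) && squarefree (m `\` msetn c v))%:R.
Proof.
move=> r0.
transitivity (\sum_(1 <= a < d.+1 | (r * a <= d)%N) \sum_(v <- finsupp m)
    \sum_(1 <= c < (m v).+1) psubst r (Pd a) (msetn c v) *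
       Eplusd (d - r * a) (m `\` msetn c v)).
  rewrite big_nat_cond [RHS]big_nat_cond; apply: eq_bigr => a /andP[/andP[a0 _] _].
  rewrite coefMp sum_submon_msetn // => b; rewrite mulf_eq0 => /norP[+ _].
  case/(psubst_Pd_neq0 r0 a0) => v [c [c0 -> _]].
  by exists v, (r * c)%N; rewrite muln_gt0 r0.
rewrite exchange_big /=; apply: eq_bigr => v _; rewrite exchange_big /=.
rewrite big_nat [RHS]big_nat; apply: eq_bigr => c /andP[c0 cm].
have degm : mdeg m = (c * vdeg v + mdeg (m `\` msetn c v))%N.
  rewrite -mdeg_msetn -mdegD msetBDKC //; apply/msubsetP => w.
  by rewrite msetnE; case: (w =P v) => // ->.
transitivity (\sum_(1 <= a < d.+1 | (r * a <= d)%N)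
    (if (r %| c)%N && (c * vdeg v == r * a)%N then
       (vdeg v)%:R * ((mdeg m == d) && squarefree (m `\` msetn c v))%:R else 0 : rat)).
  rewrite big_nat_cond [RHS]big_nat_cond; apply: eq_bigr => a /andP[/andP[a0 _] ad].
  rewrite psubst_Pd_msetn //; case: ifP => [/andP[_ /eqP E]|_]; last by rewrite mul0r.
  rewrite /Eplusd degm andbC E; congr (_ * (nat_of_bool (_ && _))%:R).
  by apply/eqP/eqP; lia.
case: (boolP (r %| c)%N) => [/dvdnP[e Ee]|_] /=; last by rewrite !mul0r big1.
rewrite mul1r; have e0 : (0 < e)%N by move: c0; rewrite Ee; case: (e).
have [le|gt] := leqP (c * vdeg v) d; last first.
  rewrite (_ : (mdeg m == d) = false); last by apply/eqP; lia.
  by rewrite mulr0 big1 // => a _; case: ifP.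
have Ec : (c * vdeg v = r * (e * vdeg v))%N by rewrite Ee mulnAC mulnC mulnA.
rewrite big_mkcond (bigD1_seq (e * vdeg v)%N) ?iota_uniq //=; last first.
  by rewrite mem_index_iota muln_gt0 e0 /= ltnS (leq_trans _ le) // Ec leq_pmull.
rewrite -Ec le eqxx big1 ?addr0 // => a ane; case: ifP => // _.
by rewrite Ec eqn_pmul2l // eq_sym (negPf ane).
Qed.

(** At a monomial [m], both sums become sums over the variables v of [m] and exponents c, with joint
    weight 1 - 2 [2 | c] = (-1)^(c+1). If [m] is square-free of degree [d], summing over c leaves
    deg(v) for each v, and these degrees add up to [d]; otherwise everything vanishes. *)
Lemma Eplusd_rec d :
  d%:R *: (Eplusd d : pseries) =
  \sum_(1 <= a < d.+1) (Pd a : pseries) * Eplusd (d - a) -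
  2%:R *: \sum_(1 <= a < d.+1 | (2 * a <= d)%N) psubst 2 (Pd a) * (Eplusd (d - 2 * a) : pseries).
Proof.
apply/funext => m; rewrite coefZp coefDp coefNp coefZp !coef_sump.
have P1 a : psubst 1 (Pd a) = Pd a.
  by apply: psubst_eqP => // b; [congr Pd; apply/msetP => v; rewrite mscaleE mul1n
    | exists b; apply/msetP => v; rewrite mscaleE mul1n].
have term1 : \sum_(1 <= a < d.+1) ((Pd a : pseries) * Eplusd (d - a)) m =
  \sum_(v <- finsupp m) \sum_(1 <= c < (m v).+1)
     (vdeg v)%:R * ((mdeg m == d) && squarefree (m `\` msetn c v))%:R.
  transitivity (\sum_(1 <= a < d.+1 | (1 * a <= d)%N)
    (psubst 1 (Pd a) * (Eplusd (d - 1 * a) : pseries)) m).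
    rewrite [RHS]big_mkcond; apply: eq_big_nat => a /andP[_ ad].
    by rewrite mul1n -ltnS ad P1.
  rewrite coef_Pd_Eplusd //; apply: eq_bigr => v _; apply: eq_bigr => c _.
  by rewrite dvd1n mul1r.
rewrite term1 coef_Pd_Eplusd // mulr_sumr -sumrB.
transitivity (\sum_(v <- finsupp m) (vdeg v)%:R * ((mdeg m == d)%:R * (squarefree m)%:R : rat)).
  rewrite /Eplusd -mulr_suml -natr_sum.
  have [sf|nsf] := boolP (squarefree m); last by rewrite !mulr0.
  have [<-|_] := eqVneq (mdeg m) d; last by rewrite mul0r !mulr0.
  rewrite !mulr1; congr _%:R; rewrite /mdeg big_seq [RHS]big_seq; apply: eq_bigr => v vm.
  move: vm; rewrite mem_finsupp; move/squarefreeP/(_ v): sf.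
  by case: (m v) => [|[|]] //; rewrite muln1.
rewrite big_seq [RHS]big_seq; apply: eq_bigr => v vm.
rewrite -(sum_sign_squarefree vm) !mulr_sumr -sumrB; apply: eq_bigr => c _.
rewrite -signr_odd dvdn2 /=; case: (odd c); case: (mdeg m == d); case: (squarefree _) => /=; ring.
Qed.

Lemma Eplusd0 : Eplusd 0 = (1 : pseries).
Proof.
apply/funext => m; rewrite /GRing.one /= /pone /Eplusd.
have [->|m0] := eqVneq m mset0.
  rewrite /mdeg /squarefree (_ : finsupp mset0 = fset0) ?big_seq_fset0 //.
  by apply/fsetP => v; rewrite mem_finsupp mset0E.
rewrite (_ : (mdeg m == 0%N) = false) ?andbF //; apply/negbTE; apply: contra m0.
rewrite /mdeg sum_nat_seq_eq0 => /allP m0; apply/eqP/msetP => v; rewrite mset0E.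
have [/m0 /=|] := boolP (v \in finsupp m); last by rewrite memNfinsupp => /eqP.
by rewrite muln_eq0 => /eqP.
Qed.

Lemma psubst_Eplusd_rec r d : (0 < r)%N ->
  d%:R *: psubst r (Eplusd d) =
  \sum_(1 <= a < d.+1) (psubst r (Pd a) : pseries) * psubst r (Eplusd (d - a)) -
  2%:R *: \sum_(1 <= a < d.+1 | (2 * a <= d)%N)
     psubst (2 * r) (Pd a) * (psubst r (Eplusd (d - 2 * a)) : pseries).
Proof.
move=> r0; rewrite -psubstZ // Eplusd_rec psubstD // -scaleN1r !psubstZ // !psubst_sum //.
rewrite scaleN1r; congr (_ - _ *: _).
  by apply: eq_bigr => a _; rewrite psubstM.
by apply: eq_bigr => a _; rewrite psubstM // psubstA // mulnC.
Qed.

(** * Types *)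

Section Counting.
Local Open Scope nat_scope.

Lemma sum_count_mem_undup (T : eqType) (s : seq T) :
  \sum_(x <- undup s) count_mem x s = size s.
Proof.
under eq_bigr do rewrite -sum1_count big_mkcond.
rewrite exchange_big /= -sum1_size big_seq [RHS]big_seq; apply: eq_bigr => y ys.
rewrite (bigD1_seq y) ?mem_undup ?undup_uniq //= eqxx big1 ?addn0 // => x.
by rewrite eq_sym => /negPf ->.
Qed.

(** Induction on the length: the rearrangements starting with [x] are counted by [rem x s], and
    removing one [x] divides the product of factorials by the multiplicity of [x]. Any [U]
    containing the letters is allowed, so that it stays fixed in the induction. *)
Lemma size_permutations_count (T : eqType) (U s : seq T) :
  uniq U -> {subset s <= U} ->
  size (permutations s) * \prod_(x <- U) (count_mem x s)`! = (size s)`!.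
Proof.
move=> uU; have [k] := ubnP (size s); elim: k s => // k IH s sk sU.
have [->|s0] := eqVneq s [::].
  by rewrite big1 // muln1.
rewrite (perm_size (permutationsE _)); last by rewrite lt0n size_eq0.
rewrite size_allpairs_dep sumnE big_map big_distrl /=.
have E x : x \in undup s ->
    size (permutations (rem x s)) * \prod_(y <- U) (count_mem y s)`! =
    count_mem x s * (size s).-1`!.
  rewrite mem_undup => xs; have xU := sU _ xs.
  have sr := size_rem xs.
  have rU : {subset rem x s <= U} by move=> y /mem_rem /sU.
  have s1 : size (rem x s) < k by move: sk xs; rewrite sr; case: (s).
  rewrite -sr -(IH _ s1 rU) mulnCA; congr (_ * _).
  have cx : 0 < count_mem x s by rewrite -has_count has_pred1.
  rewrite (bigD1_seq x) //= [in RHS](bigD1_seq x) //= mulnA; congr (_ * _).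
    by rewrite (seq.permP (perm_to_rem xs)) /= eqxx add1n factS mulnC.
  apply: eq_bigr => y yx; rewrite (seq.permP (perm_to_rem xs)) /=.
  by rewrite eq_sym (negPf yx).
rewrite big_seq (eq_bigr _ E) -big_seq -big_distrl /= sum_count_mem_undup.
by case: s s0 {sk sU E}.
Qed.

Lemma prod_count_mem (T : eqType) (U s : seq T) (F : T -> nat) :
  uniq U -> {subset s <= U} ->
  \prod_(x <- s) F x = \prod_(x <- U) F x ^ count_mem x s.
Proof.
move=> uU; elim: s => [|y s IH] sU; first by rewrite big_nil big1.
rewrite big_cons IH; last by move=> x xs; rewrite sU // inE xs orbT.
have yU : y \in U by rewrite sU // mem_head.
rewrite (bigD1_seq y) //= [in RHS](bigD1_seq y) //= eqxx expnD expn1 mulnA.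
by congr (_ * _); apply: eq_bigr => x; rewrite eq_sym => /negPf ->.
Qed.

End Counting.

Section Types.
Local Open Scope nat_scope.
Variable n : nat.
Implicit Type t : typ n.

Lemma size_tpart_le t i : size (tpart t i) <= n.
Proof. by rewrite /tpart size_map; case: (nth _ _ _) => s /=. Qed.

Lemma nth_tpart_le t i a : nth 0 (tpart t i) a <= n.
Proof.
have [ia|ia] := ltnP a (size (tpart t i)); last by rewrite nth_default.
by have /mapP[d _ ->] := mem_nth 0 ia; rewrite -ltnS; exact: ltn_ord.
Qed.

Lemma tpart_out t i : (i == 0) || (n < i) -> tpart t i = [::].
Proof.
case/orP => [/eqP -> | ni]; first by case: t => t /= /and3P[_ /eqP].
by rewrite /tpart nth_default // size_tuple.
Qed.

Lemma tpart_part t i : is_part (tpart t i).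
Proof.
have [i0|] := boolP ((i == 0) || (n < i)); first by rewrite tpart_out.
rewrite negb_or -leqNgt -lt0n => ii; case: t => t /= /and3P[/allP H _ _].
by apply: H; rewrite mem_iota add1n ltnS.
Qed.

Lemma sum_blocks t : \sum_(b <- blocks t) b.1 * b.2 = n.
Proof.
have /and3P[_ _ /eqP E] := valP t; rewrite -[RHS]E big_allpairs_dep /=.
rewrite /index_iota subSS subn0.
by apply: eq_bigr => r _; rewrite sumnE big_distrr /=; apply: eq_bigr => d _; rewrite mulnC.
Qed.

Lemma mem_blocks t d r : ((d, r) \in blocks t) = (d \in tpart t r).
Proof.
apply/allpairsPdep/idP => [[r' [d' [_ dr [-> ->]]]] //|dr].
exists r, d; split => //; rewrite mem_iota add1n ltnS.
by apply: contraLR dr; rewrite negb_and -eqn0Ngt -ltnNge => /tpart_out ->.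
Qed.

Lemma count_blocks t d r : count_mem (d, r) (blocks t) = count_mem d (tpart t r).
Proof.
rewrite -sum1_count big_mkcond big_allpairs_dep /=.
have inner r' : \sum_(d' <- tpart t r') (if (d', r') == (d, r) then 1 else 0) =
   if r' == r then count_mem d (tpart t r') else 0.
  rewrite -big_mkcond; case: eqP => [->|/eqP rr]; last first.
    by rewrite big1_idem // => i; rewrite xpair_eqE (negPf rr) andbF.
  by rewrite sum1_count; apply: eq_count => i /=; rewrite xpair_eqE eqxx andbT.
under eq_bigr do rewrite inner.
have [ri|ri] := boolP (r \in iota 1 n).
  by rewrite (bigD1_seq r) ?iota_uniq //= eqxx big1 ?addn0 // => i /negPf ->.
rewrite tpart_out /=; last by move: ri; rewrite mem_iota add1n ltnS negb_and -eqn0Ngt -ltnNge.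
by rewrite big_seq big1 // => i ii; case: eqP => // ir; rewrite -ir ii in ri.
Qed.

Lemma blocks_gt0 t b : b \in blocks t -> 0 < b.1 /\ 0 < b.2.
Proof.
case: b => d r; rewrite mem_blocks /= => dr; split.
  by rewrite lt0n; apply: contraTneq dr => ->; case/andP: (tpart_part t r).
by rewrite lt0n; apply: contraTneq dr => ->; rewrite tpart_out.
Qed.

(** A partition is the sorted list of its parts, so the block multiplicities determine every
    [tpart]. *)
Lemma blocks_inj t t' : perm_eq (blocks t) (blocks t') -> t = t'.
Proof.
move=> /seq.permP tt'; have E r : tpart t r = tpart t' r.
  apply: (@sorted_eq _ geq); [by move=> a b c ba cb; exact: leq_trans cb ba |
    by move=> a b; rewrite andbC; exact: anti_leq|..].
  - by case/andP: (tpart_part t r).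
  - by case/andP: (tpart_part t' r).
  by apply/allP => d _ /=; rewrite -!count_blocks tt'.
do 2 apply: val_inj => /=; apply: (@eq_from_nth _ [bseq]); first by rewrite !size_tuple.
move=> i _; apply: val_inj; have := E i; rewrite /tpart; exact: (inj_map val_inj).
Qed.

(** With [blocks_inj], this identifies types of [n] with multisets of blocks of total weight [n].
    The bounds built into [pretyp] hold because the weight of a block is at least its degree, its
    multiplicity and 1. *)
Lemma exists_typ (s : seq (nat * nat)) :
  all (fun b => (0 < b.1) && (0 < b.2)) s -> \sum_(b <- s) b.1 * b.2 = n ->
  exists t : typ n, perm_eq (blocks t) s.
Proof.
move=> /allP s0 sn.
pose part r := sort geq [seq b.1 | b <- s & b.2 == r].
have le b : b \in s -> b.1 <= n /\ b.2 <= n.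
  move=> bs; have /andP[b1 b2] := s0 _ bs.
  have : b.1 * b.2 <= n by rewrite -sn (big_rem b) //= leq_addr.
  by move=> h; split; apply: leq_trans h; rewrite ?leq_pmulr ?leq_pmull.
have szs : size s <= n.
  rewrite -sn -sum1_size; rewrite big_seq [leqRHS]big_seq; apply: leq_sum => b /s0.
  by rewrite muln_gt0.
have sz r : size (part r) <= n.
  by rewrite size_sort size_map size_filter (leq_trans (count_size _ _)).
have mem_part d r : (d \in part r) = ((d, r) \in s).
  rewrite mem_sort; apply/mapP/idP => [[[a b]]|ds]; last by exists (d, r); rewrite ?mem_filter ?eqxx.
  by rewrite mem_filter /= => /andP[/eqP -> ds ->].
(* [insub_bseq] and [inord] return default values outside their ranges; [sz] and [le] exclude
   this. *)
pose t0 : pretyp n := [tuple insub_bseq n [seq inord d | d <- part (val i)] | i < n.+1].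
have E r : tpart t0 r = part r.
  have [rn|rn] := leqP r n; last first.
    rewrite /tpart nth_default ?size_tuple //=.
    have: forall d, d \notin part r.
      by move=> d; rewrite mem_part; apply/negP => /le[_]; rewrite leqNgt rn.
    by case: (part r) => // d l /(_ d); rewrite mem_head.
  have -> : tpart t0 r = [seq val d | d <- tnth t0 (Ordinal (rn : r < n.+1))].
    by rewrite (tnth_nth [bseq]).
  rewrite tnth_mktuple /insub_bseq val_insubd size_map sz -map_comp.
  rewrite -[RHS]map_id; apply/eq_in_map => d /=; rewrite mem_part => /le[dn _].
  by rewrite inordK.
have typ_t0 : is_typ t0.
  apply/and3P; split.
  - apply/allP => r _; rewrite E /is_part sort_sorted; last by move=> a b; exact: leq_total.
    by rewrite mem_part; apply/negP => /s0.
  - rewrite E; have: forall d, d \notin part 0.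
      by move=> d; rewrite mem_part; apply/negP => /s0 /andP[].
    by case: (part 0) => // d l /(_ d); rewrite mem_head.
  under eq_bigr => r _.
    rewrite E sumnE (perm_big _ (permEl (perm_sort _ _))) big_map big_filter big_distrr /= big_mkcond.
    over.
  rewrite exchange_big /= -[eqbRHS]sn; apply/eqP; rewrite big_seq [RHS]big_seq.
  apply: eq_bigr => b bs; have [_ bn] := le _ bs; have /andP[_ b0] := s0 _ bs.
  rewrite (bigD1_seq b.2) ?iota_uniq ?mem_index_iota ?b0 //= eqxx mulnC big1 ?addn0 // => r.
  by rewrite eq_sym => /negPf ->.
exists (Typ typ_t0); apply/allP => -[d r] _ /=; rewrite count_blocks /= E.
rewrite (seq.permP (permEl (perm_sort _ _))) count_map count_filter; apply/eqP/eq_count => -[a b] /=.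
by rewrite xpair_eqE.
Qed.

(** [U] indexes the double product over [r] and [d] that defines [ztensor]. The powers of degrees
    are collected over the blocks; the factorials stay over [U], in the form that
    [size_permutations_count] uses. *)
Lemma ztensorE t : let U := [seq (d, r) | r <- iota 1 n, d <- iota 1 (sumn (tpart t r))] in
  [/\ uniq U, {subset blocks t <= U} &
  ztensor t = \prod_(b <- blocks t) b.1 * \prod_(b <- U) (count_mem b (blocks t))`!].
Proof.
move=> U.
have sub r : {subset tpart t r <= iota 1 (sumn (tpart t r))}.
  move=> d dr; rewrite mem_iota add1n ltnS.
  rewrite lt0n; apply/andP; split.
    by apply: contraTneq dr => ->; case/andP: (tpart_part t r).
  by rewrite sumnE (big_rem d) //= leq_addr.
split.
- apply: allpairs_uniq_dep => [|r _|]; [exact: iota_uniq | exact: iota_uniq|].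
  by move=> [r d] [r' d'] _ _ /= [-> ->].
- move=> [d r] /allpairsPdep[r' [d' [rn dr [-> ->]]]].
  by apply/allpairsPdep; exists r', d'; split => //; exact: sub.
rewrite !big_allpairs_dep -big_split /= /ztensor /index_iota subSS subn0.
apply: eq_bigr => r _; rewrite /zpart /index_iota subSS subn0.
rewrite (prod_count_mem _ (iota_uniq _ _) (@sub r)) -big_split /=.
by apply: eq_bigr => d _; rewrite count_blocks.
Qed.

End Types.

(** * Linear independence *)
Definition Pprod (s : seq (nat * nat)) : pseries :=
  \prod_(b <- s) (psubst b.2 (Pd b.1) : pseries).

Definition pos_blocks (s : seq (nat * nat)) : bool :=
  all (fun b => (0 < b.1)%N && (0 < b.2)%N) s.

(** The degree of the radical of [m]: exponents are ignored. *)
Definition supp_deg (m : monom) : nat := (\sum_(v <- finsupp m) vdeg v)%N.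

Definition supp_blocks (m : monom) : seq (nat * nat) :=
  [seq (vdeg v, m v) | v <- finsupp m].

Lemma finsupp_mset0 : finsupp (mset0 : monom) = [::] :> seq var.
Proof.
rewrite (_ : finsupp _ = fset0); first by apply: size0nil; exact: cardfs0.
by apply/fsetP => v; rewrite mem_finsupp mset0E.
Qed.

Lemma perm_finsuppD c v (m : monom) : (0 < c)%N -> v \notin finsupp m ->
  perm_eq (finsupp (msetn c v `+` m)) (v :: finsupp m).
Proof.
move=> c0 vm; apply: uniq_perm => [||w]; rewrite /= ?vm ?fset_uniq //.
rewrite inE !mem_finsupp msetE2 msetnE; case: (w == v) => //=.
by rewrite -lt0n ltn_addr.
Qed.

Lemma supp_degD c v (m : monom) : (0 < c)%N -> v \notin finsupp m ->
  supp_deg (msetn c v `+` m) = (vdeg v + supp_deg m)%N.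
Proof. by move=> c0 vm; rewrite /supp_deg (perm_big _ (perm_finsuppD c0 vm)) big_cons. Qed.

Lemma supp_degD_mem c v (m : monom) : v \in finsupp m ->
  supp_deg (msetn c v `+` m) = supp_deg m.
Proof.
move=> vm; rewrite /supp_deg; congr (bigop _ _ _); congr enum_fset.
apply/fsetP => w; rewrite !mem_finsupp msetE2 msetnE; case: (w =P v) => // ->.
by move: vm; rewrite mem_finsupp -!lt0n; lia.
Qed.

Lemma supp_blocksD c v (m : monom) : (0 < c)%N -> v \notin finsupp m ->
  perm_eq (supp_blocks (msetn c v `+` m)) ((vdeg v, c) :: supp_blocks m).
Proof.
move=> c0 vm; rewrite /supp_blocks (permPl (perm_map _ (perm_finsuppD c0 vm))) /=.
rewrite msetE2 msetnxx; move: (vm); rewrite memNfinsupp => /eqP ->; rewrite addn0.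
rewrite (eq_in_map _ (fun w => (vdeg w, m w)) _).1 // => w wm.
by rewrite msetE2 msetnE; case: (w =P v) wm vm => // -> ->.
Qed.

(* The variables of [m] split [s] into groups, the degrees in the group of [v]
   being multiples of [vdeg v]; if the degrees add up to [supp_deg m], every
   group is a single block of degree [vdeg v]. *)
Lemma Pprod_neq0 s m : pos_blocks s -> Pprod s m != 0 ->
  (supp_deg m <= \sum_(b <- s) b.1)%N /\
  ((\sum_(b <- s) b.1)%N = supp_deg m -> perm_eq s (supp_blocks m)).
Proof.
elim: s m => [|[d r] s IH] m /=.
  rewrite /Pprod big_nil /GRing.one /= /pone => _.
  have [-> _|_] := eqVneq m mset0; last by rewrite eqxx.
  by rewrite /supp_deg /supp_blocks finsupp_mset0 !big_nil.
case/andP=> /andP[/= d0 r0] s0; rewrite /Pprod big_cons -/(Pprod s).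
case/coefMp_neq0 => a [am /(psubst_Pd_neq0 r0 d0)[v [c [c0 Ea cv]]] /(IH _ s0)].
move/msetBDKC: am; move: (m `\` a) => m' <- {m}.
rewrite big_cons {}Ea /= => -[le eq].
have rc0 : (0 < r * c)%N by rewrite muln_gt0 r0.
have vd : (vdeg v <= d)%N by rewrite -cv leq_pmull.
have [vm|vm] := boolP (v \in finsupp m').
  by rewrite (supp_degD_mem _ vm); split; lia.
rewrite (supp_degD rc0 vm); split; first by lia.
move=> E; rewrite (permPr (supp_blocksD rc0 vm)).
have [Ed Es] : d = vdeg v /\ (\sum_(b <- s) b.1)%N = supp_deg m' by lia.
have -> : c = 1%N by apply/eqP; rewrite -(eqn_pmul2r (vdeg_gt0 v)) cv mul1n Ed.
by rewrite muln1 Ed perm_cons eq.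
Qed.

Lemma psubst_Pd_ge0 r d m : (0 < r)%N -> (0 < d)%N -> 0 <= psubst r (Pd d) m.
Proof.
move=> r0 d0; have [-> //|nz] := eqVneq (psubst r (Pd d) m) 0.
have [v [c [c0 -> _]]] := psubst_Pd_neq0 r0 d0 nz.
by rewrite psubst_Pd_msetn // ?muln_gt0 ?r0 //; case: ifP.
Qed.

Lemma Pprod_ge0 s m : pos_blocks s -> 0 <= Pprod s m.
Proof.
elim: s m => [|[d r] s IH] m /=; first by rewrite /Pprod big_nil => _; exact: ler0n.
case/andP=> /andP[/= d0 r0] s0; rewrite /Pprod big_cons -/(Pprod s) coefMp.
by apply: sumr_ge0 => a _; rewrite mulr_ge0 ?psubst_Pd_ge0 ?IH.
Qed.

(** The second index runs upwards from [k], which keeps the variables distinct; [b.1.-1] appears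
    because the variable [(i, j)] has degree i + 1. *)
Fixpoint block_monom (k : nat) (s : seq (nat * nat)) : monom :=
  if s is b :: s' then msetn b.2 (b.1.-1, k) `+` block_monom k.+1 s' else mset0.

Lemma block_monom_fresh k s v : v \in finsupp (block_monom k s) -> (k <= v.2)%N.
Proof.
elim: s k => [|b s IH] k /=; first by rewrite mem_finsupp mset0E.
rewrite mem_finsupp msetE2 msetnE; case: (v =P _) => [->|_] //=; rewrite add0n => vm.
by apply: ltnW; apply: IH; rewrite mem_finsupp.
Qed.

Lemma supp_deg_block_monom k s : pos_blocks s ->
  supp_deg (block_monom k s) = (\sum_(b <- s) b.1)%N.
Proof.
elim: s k => [|[d r] s IH] k /=.
  by rewrite /supp_deg finsupp_mset0 !big_nil.
case/andP=> /andP[/= d0 r0] s0; rewrite supp_degD //; last first.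
  by apply/negP => /block_monom_fresh; rewrite ltnn.
by rewrite IH // big_cons /vdeg /= prednK.
Qed.

(** The factorization that splits off the power of the first block's variable contributes a positive
    term, and no other term is negative. *)
Lemma Pprod_block_monom k s : pos_blocks s -> 0 < Pprod s (block_monom k s).
Proof.
elim: s k => [|[d r] s IH] k /=; first by rewrite /Pprod big_nil /GRing.one /= /pone eqxx.
case/andP=> /andP[/= d0 r0] s0; rewrite /Pprod big_cons -/(Pprod s) coefMp.
set a := msetn r (d.-1, k); set m' := block_monom _ _.
rewrite (bigD1_seq a) ?submon_uniq //=; last first.
  by rewrite mem_submon; apply/msubsetP => v; rewrite msetE2 leq_addr.
apply: ltr_wpDr; first by apply: sumr_ge0 => b _; rewrite mulr_ge0 ?psubst_Pd_ge0 ?Pprod_ge0.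
rewrite msetDKB mulr_gt0 ?IH // psubst_Pd_msetn // dvdnn /vdeg /= prednK // eqxx.
by rewrite ltr0n.
Qed.

(** Among the types with nonzero coefficient, [rho] has the largest sum of block degrees, and [m] is
    its monomial. Any other such type with [m] in the support of its product has degree sum at
    least, hence equal to, that of [rho], and therefore the same blocks. *)
Lemma ptyp_Pd_free n (c : typ n -> rat) :
  (forall m, \sum_(rho : typ n) c rho * ptyp Pd rho m = 0) -> forall rho, c rho = 0.
Proof.
move=> c0 rho0; apply/eqP; apply: contrapT => /negP rho0P.
pose D (rho : typ n) := (\sum_(b <- blocks rho) b.1)%N.
have pos (rho : typ n) : pos_blocks (blocks rho).
  by apply/allP => b /blocks_gt0[-> ->].
have [rho rhoP max] := @arg_maxnP _ rho0 (fun rho => c rho != 0) D rho0P.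
pose m := block_monom 0 (blocks rho).
have := c0 m; rewrite (bigD1 rho) //= big1 ?addr0 => [/eqP|rho' ne].
  by rewrite mulf_eq0 (negPf rhoP) /= gt_eqF // Pprod_block_monom.
have [->|c'] := eqVneq (c rho') 0; first by rewrite mul0r.
have [->|nz] := eqVneq (ptyp Pd rho' m) 0; first by rewrite mulr0.
have [le eq] := Pprod_neq0 (pos rho') nz.
have [_ eqr] := Pprod_neq0 (pos rho) (lt0r_neq0 (Pprod_block_monom 0 (pos rho))).
rewrite -/m supp_deg_block_monom // in le eq eqr.
case/eqP: ne; apply: blocks_inj; rewrite (permPl (eq _)) 1?perm_sym ?eqr //.
by apply/eqP; rewrite eqn_leq le andbT; exact: max.
Qed.

(** * Words and the exponential formula *)

Section Words.
Variables (K : comNzRingType) (A : comAlgType K) (X : finType) (V : zmodType).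
Variables (v : X -> V) (w : X -> A).

(** The coefficient of z^D in the s-th power of g = sum_x w(x) z^(v(x)), computed by removing the
    first letter. *)
Fixpoint words s (D : V) : A :=
  if s is s'.+1 then \sum_x w x * words s' (D - v x) else (D == 0)%:R.

Lemma words_tupleE s D :
  words s D = \sum_(t : s.-tuple X | \sum_(x <- t) v x == D) \prod_(x <- t) w x.
Proof.
elim: s D => [|s IH] D /=.
  rewrite big_mkcond (big_pred1 [tuple]) => [|t]; last exact/esym/eqP/tuple0.
  by rewrite !big_nil eq_sym; case: eqP.
rewrite [RHS](reindex (fun q : X * s.-tuple X => [tuple of q.1 :: q.2])) /=; last first.
  exists (fun t => (thead t, [tuple of behead t])) => [[x t] _ | t _] /=.
    by rewrite theadE; congr pair; apply: val_inj.
  by rewrite [RHS]tuple_eta; apply: val_inj.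
rewrite [RHS]big_mkcond -(pair_bigA _ (fun x (t : s.-tuple X) =>
  if \sum_(y <- x :: t) v y == D then \prod_(y <- x :: t) w y else 0)) /=.
apply: eq_bigr => x _; rewrite IH mulr_sumr [LHS]big_mkcond; apply: eq_bigr => t _.
by rewrite !big_cons eq_sym subr_eq addrC eq_sym.
Qed.

(** For theta the derivation sending z^D to delta(D) z^D, and g the generating function of the
    letters, this is theta(g^(s+1)) = (s+1) theta(g) g^s. *)
Lemma words_deriv (delta : {additive V -> K}) s D :
  delta D *: words s.+1 D =
  s.+1%:R *: \sum_x delta (v x) *: (w x * words s (D - v x)).
Proof.
elim: s D => [|s IH] D.
  rewrite scale1r /= scaler_sumr; apply: eq_bigr => x _.
  have [/eqP|_] := eqVneq (D - v x) 0; last by rewrite mulr0 !scaler0.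
  by rewrite subr_eq0 => /eqP ->.
rewrite [words]lock /= -lock.
have -> : words s.+2 D = \sum_x w x * words s.+1 (D - v x) by [].
have split x : delta D *: (w x * words s.+1 (D - v x)) =
    delta (v x) *: (w x * words s.+1 (D - v x)) + w x * (delta (D - v x) *: words s.+1 (D - v x)).
  by rewrite -scalerAr -scalerDl -raddfD (addrC (v x)) subrK.
rewrite scaler_sumr (eq_bigr _ (fun x _ => split x)) big_split /= -natr1 scalerDl scale1r addrC.
congr (_ + _); under eq_bigr => x _ do rewrite IH -scalerAr mulr_sumr.
rewrite -scaler_sumr exchange_big /=; congr (_ *: _).
apply: eq_bigr => y _; rewrite mulr_sumr scaler_sumr; apply: eq_bigr => x _.
by rewrite -scalerAr !mulrA (mulrC (w x)) -!addrA (addrC (- v x)).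
Qed.
End Words.

(** * The exponential formula for a product over rows *)

Section ExponentialFormula.
Variables (A : comAlgType rat) (p e : nat -> nat -> A) (J : finType) (R : J -> nat) (N : nat).
Hypothesis e0 : forall r, e 0 r = 1.
Hypothesis erec : forall d r, d%:R *: e d r =
  \sum_(1 <= a < d.+1) p a r * e (d - a) r -
  2%:R *: \sum_(1 <= a < d.+1 | (2 * a <= d)%N) p a (2 * r) * e (d - 2 * a) r.

(* The letter [(j, b, a)] puts in row [j] a brick ([b = false]) or a
   doublebrick ([b = true]) whose block has degree [a.+1]. *)
Definition letter : finType := (J * bool * 'I_N)%type.
Definition letter_block (x : letter) : nat * nat := (x.2.+1, x.1.2.+1 * R x.1.1)%N.
Definition letter_len (x : letter) : nat := (x.1.2.+1 * x.2.+1)%N.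
Definition letter_vec (x : letter) : {ffun J -> int} :=
  [ffun j => if j == x.1.1 then (letter_len x)%:Z else 0].
(** A term of the logarithm of the generating series of a row of multiplicity R: P_(d^R) / d for a
    brick, - P_(d^(2R)) / d for a doublebrick. *)
Definition letter_weight (x : letter) : A :=
  ((-1) ^+ x.1.2 / x.2.+1%:R) *: p (letter_block x).1 (letter_block x).2.

(** Zero at negative arguments, so that terms out of range drop out of the recursion by
    themselves. *)
Definition e_int (k : int) (r : nat) : A := if k is Posz d then e d r else 0.
Definition eprod (D : {ffun J -> int}) : A := \prod_j e_int (D j) (R j).

Lemma e_int_lt0 k r : k < 0 -> e_int k r = 0.
Proof. by case: k. Qed.

Lemma e_int_sum c (g : nat -> A) d r : (0 < c)%N -> (d <= N)%N ->
  \sum_(a < N) g a.+1 * e_int (d%:Z - (c * a.+1)%:Z) r =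
  \sum_(1 <= a < d.+1 | (c * a <= d)%N) g a * e (d - c * a) r.
Proof.
move=> c0 dN.
transitivity (\sum_(1 <= a < N.+1) g a * e_int (d%:Z - (c * a)%:Z) r).
  by rewrite big_add1 /= big_mkord.
rewrite (big_cat_nat (n := d.+1)) //= [X in _ + X]big_nat [X in _ + X]big1 ?addr0; last first.
  move=> a /andP[da _]; rewrite e_int_lt0 ?mulr0 //.
  have : (a <= c * a)%N by rewrite leq_pmull.
  lia.
rewrite [RHS]big_mkcond; apply: eq_bigr => a _; case: leqP => [le|gt].
  by rewrite subzn.
by rewrite e_int_lt0 ?mulr0 //; lia.
Qed.

(** The bound on [k] makes block degrees up to [N] enough: terms of larger degree would have a
    negative argument. *)
Lemma e_int_rec k r : k <= N%:Z ->
  k%:~R *: e_int k r = \sum_(a < N) p a.+1 r * e_int (k - a.+1%:Z) r -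
    2%:R *: \sum_(a < N) p a.+1 (2 * r) * e_int (k - (2 * a.+1)%:Z) r.
Proof.
case: k => [d|d] dN; last first.
  by rewrite scaler0 !big1 ?scaler0 ?subr0 // => a _; rewrite e_int_lt0 ?mulr0 //; lia.
rewrite -pmulrn erec (@e_int_sum 2 (fun a => p a (2 * r)%N)) //; congr (_ - _).
have := @e_int_sum 1 (p ^~ r) d r isT dN.
under eq_bigr do rewrite mul1n.
move=> ->; rewrite [RHS]big_mkcond; apply: eq_big_nat => a /andP[_ ad].
by rewrite mul1n -ltnS ad.
Qed.

Definition total (D : {ffun J -> int}) : rat := (\sum_j D j)%:~R.

Fact total_additive : zmod_morphism total.
Proof.
move=> D E; rewrite /total -intrB -sumrB; congr _%:~R.
by apply: eq_bigr => j _; rewrite !ffunE.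
Qed.
HB.instance Definition _ := GRing.isZmodMorphism.Build _ _ total total_additive.

Lemma total_letter x : total (letter_vec x) = (letter_len x)%:R.
Proof.
rewrite /total (bigD1 x.1.1) //= ffunE eqxx big1 ?addr0 // => j /negPf jx.
by rewrite ffunE jx.
Qed.

(** A Leibniz rule over the rows: [total D] is a sum over rows, and each entry times its own factor
    is rewritten by [e_int_rec]. The length of a letter cancels the denominator of its weight,
    leaving the coefficients 1 for bricks and -2 for doublebricks. *)
Lemma eprod_rec (D : {ffun J -> int}) : (forall j, D j <= N%:Z) ->
  total D *: eprod D = \sum_x total (letter_vec x) *: (letter_weight x * eprod (D - letter_vec x)).
Proof.
move=> DN; rewrite -(pair_bigA _ (fun jb a => total (letter_vec (jb, a)) *:
  (letter_weight (jb, a) * eprod (D - letter_vec (jb, a))))) /=.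
rewrite -(pair_bigA _ (fun j b => \sum_a total (letter_vec (j, b, a)) *:
  (letter_weight (j, b, a) * eprod (D - letter_vec (j, b, a))))) /=.
rewrite /total rmorph_sum /= scaler_suml; apply: eq_bigr => j _.
pose rest := \prod_(i | i != j) e_int (D i) (R i).
have term b a : total (letter_vec (j, b, a)) *:
    (letter_weight (j, b, a) * eprod (D - letter_vec (j, b, a))) =
    ((-1) ^+ b * b.+1%:R) *: (p a.+1 (b.+1 * R j) * e_int (D j - (b.+1 * a.+1)%:Z) (R j)) * rest.
  rewrite total_letter /letter_weight /eprod (bigD1 j) //= !ffunE eqxx -/rest.
  rewrite (eq_bigr (fun i => e_int (D i) (R i))) => [|i /negPf ij]; last first.
    by rewrite !ffunE /= ij subr0.
  rewrite -/rest mulrA -!scalerAl scalerA /letter_len /= natrM; congr (_ *: _).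
  by rewrite mulrACA divff ?pnatr_eq0 // mulr1 mulrC.
under eq_bigr => b _ do [under eq_bigr => a _ do rewrite term; rewrite -mulr_suml -scaler_sumr].
rewrite big_bool /= /eprod (bigD1 j) //= -/rest scalerAl e_int_rec // -mulrDl; congr (_ * _).
rewrite !expr0 expr1 !mulN1r mul1r scale1r scaleNr [RHS]addrC; congr (_ - _).
by apply: eq_bigr => a _; rewrite !mul1n.
Qed.

Lemma ffun_subE (D E : {ffun J -> int}) j : (D - E) j = D j - E j.
Proof. by rewrite !ffunE. Qed.

Lemma letter_vec_ge0 x j : 0 <= letter_vec x j.
Proof. by rewrite ffunE; case: eqP. Qed.

Lemma words_lt0 s (D : {ffun J -> int}) j : D j < 0 -> words letter_vec letter_weight s D = 0.
Proof.
elim: s D => [|s IH] D Dj /=.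
  by case: eqP Dj => // ->; rewrite ffunE ltxx.
rewrite big1 // => x _; rewrite IH ?mulr0 // ffun_subE.
by have := letter_vec_ge0 x j; lia.
Qed.

(** Induction on [M]: by [eprod_rec] and [words_deriv] both sides satisfy the same recursion, which
    determines them when [total D] is nonzero. The truncation is harmless, since every letter has
    positive length. *)
Lemma eprod_words M (D : {ffun J -> int}) :
  (forall j, D j <= N%:Z) -> \sum_j D j < M%:Z ->
  eprod D = \sum_(s < M) (s`!%:R)^-1 *: words letter_vec letter_weight s D.
Proof.
elim: M D => [|M IH] D DN DM.
  have [j Dj] : exists j, D j < 0.
    apply/existsP; apply: contraLR DM; rewrite negb_exists => /forallP D0.
    by rewrite -leNgt; apply: sumr_ge0 => j _; rewrite leNgt D0.
  by rewrite big_ord0 /eprod (bigD1 j) //= e_int_lt0 // mul0r.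
have [/existsP[j Dj]|] := boolP [exists j, D j < 0].
  rewrite /eprod (bigD1 j) //= e_int_lt0 // mul0r big1 // => s _.
  by rewrite (words_lt0 _ Dj) scaler0.
rewrite negb_exists => /forallP D0.
have {}D0 j : 0 <= D j by rewrite leNgt D0.
rewrite big_ord_recl /= fact0 invr1 scale1r.
(* For [D = 0] only the empty word counts: any letter would make an entry negative. *)
have [E|Dn0] := eqVneq D 0.
  rewrite E /eprod big1 => [|j _]; last by rewrite ffunE /= e0.
  rewrite big1 ?addr0 // => s _; rewrite big1 ?scaler0 // => x _.
  rewrite (@words_lt0 _ _ x.1.1) ?mulr0 // !ffunE eqxx sub0r /letter_len; lia.
have tot0 : total D != 0.
  rewrite intr_eq0 psumr_eq0 //; apply: contra Dn0 => /allP D1.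
  by apply/eqP/ffunP => j; rewrite ffunE; apply/eqP; apply: D1; rewrite mem_index_enum.
apply: (scalerI tot0); rewrite add0r eprod_rec // scaler_sumr.
(* The factor s + 1 from [words_deriv] turns 1/(s+1)! into 1/s!, as the induction hypothesis
   needs. *)
under [RHS]eq_bigr => s _.
  rewrite /bump /= add1n scalerA mulrC -scalerA words_deriv scalerA factS natrM invfM -mulrA.
  rewrite mulrCA mulVf ?pnatr_eq0 // mulr1 scaler_sumr.
  over.
rewrite exchange_big /=; apply: eq_bigr => x _.
have len0 : (0 < letter_len x)%N by [].
rewrite IH.
- rewrite mulr_sumr scaler_sumr; apply: eq_bigr => s _.
  by rewrite -scalerAr !scalerA mulrC.
- by move=> j; rewrite ffun_subE; have := letter_vec_ge0 x j; have := DN j; lia.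
under eq_bigr do rewrite ffun_subE.
rewrite sumrB [X in _ - X](_ : _ = (letter_len x)%:Z).
  by move: DM len0; move: (\sum_j D j) (letter_len x) => S l; lia.
under eq_bigr do rewrite ffunE.
by rewrite -big_mkcond big_pred1_eq.
Qed.

End ExponentialFormula.

Arguments letter_block {J} R {N} x.
Arguments letter_vec {J N} x.
Arguments letter_weight {A} p {J} R {N} x.

(** * Tabloids *)

Section Segments.
Local Open Scope nat_scope.
Import finset.
Variable n : nat.
Implicit Types (j : 'I_n.+1 * 'I_n) (U : {set cell n}).

Definition segment j a b : {set cell n} := [set x : cell n | (x.1 == j) && (a <= x.2 < b)].

Lemma card_segment j a b : b <= n -> #|segment j a b| = b - a.
Proof.
move=> bn; have lt (k : 'I_(b - a)) : a + k < n.
  by rewrite (leq_trans _ bn) // -ltn_subRL.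
rewrite -[RHS]card_ord -(card_imset _ (f := fun k : 'I_(b - a) => (j, Ordinal (lt k)))); last first.
  by move=> k l [/addnI kl]; apply: val_inj.
apply: eq_card => -[i y]; rewrite inE /=; apply/idP/imsetP => [/and3P[/eqP -> ay yb]|[k _ [-> ->]]].
  have yab : y - a < b - a by rewrite ltn_sub2rE.
  by exists (Ordinal yab) => //; congr pair; apply: val_inj; rewrite /= subnKC.
by rewrite eqxx leq_addr /= -ltn_subRL.
Qed.

(** Let [y] be a cell of row [j]. If [y] is in [U], so are all cells before it, and [U] has more
    than [y.2] cells; otherwise [U] lies strictly before [y] and has at most [y.2] cells. *)
Lemma down_closed_segment j U : {in U, forall x, x.1 = j} ->
  (forall x y : cell n, x \in U -> y.1 = j -> y.2 < x.2 -> y \in U) -> U = segment j 0 #|U|.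
Proof.
move=> Uj Ud; apply/setP => y; rewrite inE /=.
have [yj|yj] /= := eqVneq y.1 j; last by apply/negP => /Uj /eqP; rewrite (negPf yj).
have eqxy (x : cell n) : x.1 = j -> x.2 = y.2 -> x = y.
  by move: yj; case: (x) (y) => [x1 x2] [y1 y2] /= -> -> ->.
have [yU|yU] := boolP (y \in U); apply/esym.
  rewrite -[X in X <= _](card_segment j 0 (ltn_ord y.2)).
  apply/subset_leq_card/fintype.subsetP => x; rewrite inE ltnS /= => /andP[/eqP xj].
  by rewrite leq_eqVlt => /orP[/eqP/val_inj/(eqxy _ xj) ->|]; last exact: Ud yU xj.
apply/negbTE; rewrite -leqNgt -[X in _ <= X](subn0 y.2) -(card_segment j 0 (ltnW (ltn_ord y.2))).
apply/subset_leq_card/fintype.subsetP => x xU; have xj := Uj _ xU; rewrite inE xj eqxx /= ltnNge.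
apply: contra yU; rewrite leq_eqVlt => /orP[/eqP/val_inj/esym/(eqxy _ xj) <- //|].
exact: Ud xU yj.
Qed.

Lemma segmentS j a b c : a <= b -> segment j a c :\: segment j a b = segment j b c.
Proof.
move=> ab; apply/setP => x; rewrite !inE /=; case: (x.1 == j) => //=; rewrite ?andbF //.
by apply/idP/idP; lia.
Qed.

End Segments.

(** * Tabloids as assignments of labels to rows *)

Section Tabloids.
Local Open Scope nat_scope.
Import finset.
Variables (n : nat) (sigma tau : typ n).

Definition row_len (j : 'I_n.+1 * 'I_n) : nat := nth 0 (tpart sigma j.1) j.2.

Definition block_at (i : label tau) : nat * nat := nth (0, 0) (blocks tau) i.

(* [f i] is the row of the object labeled [i], and whether it is a doublebrick. *)
Definition placement := {ffun label tau -> ('I_n.+1 * 'I_n) * bool}.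
Implicit Types (f : placement) (T : pretabloid tau).

Definition placed_len f (i : label tau) : nat := (f i).2.+1 * (block_at i).1.

(** The column where the object labeled [k] has to start if it lies in row [j]. *)
Definition prefix_len f j k : nat := \sum_(i : label tau | (i < k) && ((f i).1 == j)) placed_len f i.

Definition is_placement f : bool :=
  [forall i, (block_at i).2 == (f i).2.+1 * (f i).1.1] &&
  [forall j, prefix_len f j (size (blocks tau)) == row_len j].

Definition tabloid_of f : pretabloid tau :=
  [ffun i => (segment (f i).1 (prefix_len f (f i).1 i) (prefix_len f (f i).1 i.+1), (f i).2)].

Lemma row_len_le j : row_len j <= n. Proof. exact: nth_tpart_le. Qed.

Lemma mem_tdiagram x : (x \in tdiagram sigma) = (x.2 < row_len x.1).
Proof. by rewrite inE. Qed.

Lemma prefix_lenS f j (i : label tau) :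
  prefix_len f j i.+1 = prefix_len f j i + (if (f i).1 == j then placed_len f i else 0).
Proof.
rewrite /prefix_len big_mkcond (bigD1 i) //= ltnS leqnn /= addnC; congr (_ + _).
rewrite [RHS]big_mkcond [RHS](bigD1 i) //= ltnn /= add0n; apply: eq_bigr => k ki.
by rewrite ltnS leq_eqVlt (_ : (k == i :> nat) = false) //; apply/negbTE.
Qed.

Lemma prefix_len_mono f j k l : k <= l -> prefix_len f j k <= prefix_len f j l.
Proof.
move=> kl; rewrite /prefix_len big_mkcond [leqRHS]big_mkcond; apply: leq_sum => i _.
by case: andP => // -[ik ->]; rewrite (leq_trans ik).
Qed.

Lemma prefix_len_block f (i : label tau) :
  prefix_len f (f i).1 i.+1 = prefix_len f (f i).1 i + placed_len f i.
Proof. by rewrite prefix_lenS eqxx. Qed.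

Lemma block_at_gt0 i : 0 < (block_at i).1 /\ 0 < (block_at i).2.
Proof. by apply: (@blocks_gt0 _ tau); rewrite mem_nth. Qed.

Lemma placed_len_gt0 f i : 0 < placed_len f i.
Proof. by rewrite muln_gt0 /=; case: (block_at_gt0 i). Qed.

Lemma tabloid_of_odoub f : is_placement f -> tabloid_of f \in PTodoub sigma tau.
Proof.
case/andP=> /forallP blk /forallP row; rewrite inE.
have top j k : k <= size (blocks tau) -> prefix_len f j k <= row_len j.
  by move=> ks; rewrite -(eqP (row j)) prefix_len_mono.
have mem i x : (x \in (tabloid_of f i).1) = (x.1 == (f i).1) &&
   (prefix_len f (f i).1 i <= x.2 < prefix_len f (f i).1 i.+1) by rewrite ffunE inE.
apply/and4P; split.
- apply/forallP => i /=; rewrite -/(block_at i).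
  have cardT : #|(tabloid_of f i).1| = placed_len f i.
    by rewrite ffunE card_segment ?prefix_len_block ?addKn // -prefix_len_block
      (leq_trans (top _ _ _)) // row_len_le.
  apply/andP; split.
    apply/andP; split; first by rewrite -card_gt0 cardT placed_len_gt0.
    apply/forallP => x; apply/implyP; rewrite mem => /and3P[/eqP xr x1 x2].
    apply/forallP => y; apply/implyP; rewrite mem => /and3P[/eqP yr y1 y2].
    rewrite xr yr eqxx; apply/forallP => z; apply/implyP; rewrite mem => /and3P[-> zx zy] /=.
    by rewrite (leq_trans x1 zx) (leq_ltn_trans zy).
  have fac r : r = (f i).1.1 :> nat -> in_factor (tabloid_of f i).1 r.
    by move=> ->; apply/forallP => x; apply/implyP; rewrite mem => /and3P[/eqP -> _ _].
  have := eqP (blk i); rewrite cardT /placed_len (_ : (tabloid_of f i).2 = (f i).2) /=; last by rewrite ffunE.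
  case: (f i).2 => /= E; rewrite E; last by rewrite !mul1n eqxx fac.
  by rewrite eqxx mul2n odd_double doubleK fac.
- apply/forallP => i; apply/forallP => i'; apply/implyP => ii'.
  rewrite disjoint_subset; apply/fintype.subsetP => x; rewrite !inE !mem.
  case/and3P => /eqP xr x1 x2; apply/negP => /and3P[/eqP xr' x3 x4].
  rewrite -xr in x1 x2; rewrite -xr' in x3 x4.
  have /orP[lt|lt] : (i < i') || (i' < i) by rewrite -neq_ltn.
    by have := leq_trans (leq_ltn_trans x3 x2) (prefix_len_mono f x.1 lt); rewrite ltnn.
  by have := leq_trans (leq_ltn_trans x1 x4) (prefix_len_mono f x.1 lt); rewrite ltnn.
- apply/eqP/setP => x; rewrite mem_tdiagram; apply/bigcupP/idP => [[i _]|].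
    by rewrite mem => /and3P[/eqP -> _ xi]; rewrite (leq_trans xi) // top.
  rewrite -(eqP (row x.1)) => xs.
  (* For the least [k] such that the labels below [k] reach past the cell [x], the object labeled k
     - 1 contains [x]. *)
  have [k xk min] := find_ex_minn (ex_intro (fun k => x.2 < prefix_len f x.1 k) _ xs).
  case: k xk min => [|k] xk min; first by rewrite /prefix_len big_pred0 in xk.
  have kx : prefix_len f x.1 k <= x.2.
    by rewrite leqNgt; apply/negP => /min; rewrite ltnn.
  have ks : k < size (blocks tau) by have := min _ xs.
  exists (Ordinal ks) => //; rewrite mem.
  have := prefix_lenS f x.1 (Ordinal ks); case: eqP => [-> _|_ E].
    by rewrite eqxx kx.
  by move: xk; rewrite E addn0 ltnNge kx.
apply/forallP => i; apply/forallP => i'; apply/forallP => x; apply/implyP; rewrite mem.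
case/and3P => /eqP xr x1 x2; apply/forallP => y; apply/implyP; rewrite mem.
case/and3P => /eqP yr y1 y2; apply/implyP => /andP[/eqP xy lt].
rewrite leqNgt; apply/negP => i'i.
have := leq_ltn_trans (leq_trans (prefix_len_mono f (f i).1 i'i) x1) lt.
by rewrite -xr xy yr ltnNge ltnW // -yr.
Qed.

Lemma tabloid_of_inj : {in is_placement &, injective tabloid_of}.
Proof.
move=> f g /tabloid_of_odoub; rewrite inE => /and4P[/forallP ok _ _ _] _ E.
apply/ffunP => i; have /andP[/andP[/set0Pn[x xf] _] _] := ok i.
have xg := xf; rewrite E in xg; move: xf xg; rewrite !ffunE !inE.
case/and3P => /eqP xf _ _ /and3P[/eqP xg _ _].
have := congr1 (fun T : pretabloid tau => (T i).2) E; rewrite !ffunE /=.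
by case: (f i) (g i) xf xg => [a b] [c d] /= <- <- ->.
Qed.

(** Each object lies in a single row, which gives the placement; the increasing labels then force
    the position of each object in its row. *)
Lemma tabloid_of_surj T : T \in PTodoub sigma tau ->
  exists2 f, is_placement f & T = tabloid_of f.
Proof.
rewrite inE => /and4P[/forallP ok /forallP disj /eqP cover /forallP ord].
have [g gP] : exists g : label tau -> 'I_n.+1 * 'I_n, forall i, {in (T i).1, forall x, x.1 = g i}.
  apply: (@fin_all_exists _ (fun=> ('I_n.+1 * 'I_n)%type) (fun i j => {in (T i).1, forall x, x.1 = j})) => i.
  have /andP[/andP[/set0Pn[x xT] /forallP bT] _] := ok i.
  exists x.1 => y yT; have /implyP/(_ yT)/forallP/(_ x)/implyP/(_ xT)/andP[/eqP] := bT y.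
  by [].
pose f : placement := [ffun i => (g i, (T i).2)].
have f1 i : (f i).1 = g i by rewrite ffunE.
have f2 i : (f i).2 = (T i).2 by rewrite ffunE.
have cardT i : #|(T i).1| = placed_len f i.
  have /andP[_] := ok i; rewrite /placed_len ffunE /= -/(block_at i).
  by case: (T i).2 => [/and3P[_ /eqP -> _]|/andP[/eqP -> _]]; rewrite ?mul1n.
have inT i x : x \in (T i).1 -> x \in tdiagram sigma.
  by move=> xT; rewrite -cover; apply/bigcupP; exists i.
have disjT i i' x : x \in (T i).1 -> x \in (T i').1 -> i = i'.
  move=> xi xi'; apply/eqP; apply: contraLR isT => ii'.
  by have /implyP/(_ ii')/pred0P/(_ x) := forallP (disj i) i'; rewrite /= xi xi'.
(* As labels increase along a row, the objects with labels below [k] fill an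
   initial segment of it. *)
pose U j k : {set cell n} := \bigcup_(i : label tau | (i < k) && (g i == j)) (T i).1.
have cardU j k : #|U j k| = prefix_len f j k.
  rewrite /prefix_len (eq_bigl (fun i : label tau => (i < k) && (g i == j))) => [|i]; last by rewrite f1.
  rewrite -(eq_bigr _ (fun i _ => cardT i)) /U -!big_enum_cond /=.
  rewrite -!(big_filter (enum _)); set s := filter _ _.
  have : uniq s by rewrite filter_uniq // enum_uniq.
  elim: s => [|i s IH] /=; first by rewrite !big_nil cards0.
  case/andP=> ins us; rewrite !big_cons -IH // cardsU.
  rewrite (_ : _ :&: _ = finset.set0) ?cards0 ?subn0 //; apply/setP => x; rewrite !inE.
  apply/negP => /andP[xi]; rewrite finset.bigcup_seq => /bigcupP[i' i's xi'].
  by rewrite (disjT _ _ _ xi xi') i's in ins.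
have Useg j k : U j k = segment j 0 (prefix_len f j k).
  rewrite -cardU; apply: down_closed_segment => [x /bigcupP[i /andP[_ /eqP <-]]|x y]; first exact: gP.
  case/bigcupP=> i /andP[ik /eqP gi] xi yj yx.
  have : y \in tdiagram sigma.
    have := inT _ _ xi; rewrite !mem_tdiagram yj -gi -(gP _ _ xi); exact: ltn_trans.
  rewrite -cover => /bigcupP[i' _ yi']; apply/bigcupP; exists i' => //.
  rewrite -(gP _ _ yi') yj eqxx andbT; apply: leq_ltn_trans ik.
  have /forallP/(_ y)/implyP/(_ yi')/forallP/(_ x)/implyP/(_ xi)/implyP := forallP (ord i') i.
  by apply; rewrite yx (gP _ _ xi) yj gi eqxx.
exists f.
  apply/andP; split.
    apply/forallP => i; have /andP[/andP[/set0Pn[x xT] _]] := ok i.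
    rewrite -/(block_at i) !ffunE /=.
    case: (T i).2 => [/and3P[odd_r _]|/andP[_]] /forallP/(_ x); rewrite xT (gP _ _ xT) => /= /eqP ->.
      by rewrite mul2n even_halfK.
    by rewrite mul1n.
  apply/forallP => j; rewrite -cardU.
  rewrite (_ : U _ _ = segment j 0 (row_len j)) ?card_segment ?subn0 ?row_len_le //.
  apply/setP => x; rewrite inE /=; apply/bigcupP/andP => [[i /andP[_ /eqP gi] xi]|[/eqP xj]].
    by have := inT _ _ xi; rewrite mem_tdiagram -gi (gP _ _ xi) eqxx.
  rewrite -xj -mem_tdiagram -cover => /bigcupP[i _ xi]; exists i => //.
  by rewrite ltn_ord -(gP _ _ xi) xj eqxx.
(* The object labeled [i] is what [U] gains in its row between [i] and i + 1. *)
apply/ffunP => i; rewrite [RHS]ffunE f1 f2 [LHS]surjective_pairing; congr pair.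
rewrite -(segmentS _ _ (leq0n _)) -!Useg; apply/setP => x; rewrite inE.
apply/idP/andP => [xi|[]].
  split; last by apply/bigcupP; exists i => //; rewrite ltnS leqnn eqxx.
  by apply/bigcupP => -[i' /andP[i'i _] xi']; rewrite (disjT _ _ _ xi xi') ltnn in i'i.
move=> nU /bigcupP[i' /andP[]]; rewrite ltnS leq_eqVlt => /orP[/eqP/val_inj -> //|i'i gi xi'].
by case/bigcupP: nU; exists i' => //; rewrite i'i.
Qed.

Lemma sum_PTodoub (V : nmodType) (F : pretabloid tau -> V) :
  (\sum_(T in PTodoub sigma tau) F T = \sum_(f | is_placement f) F (tabloid_of f))%R.
Proof.
rewrite (_ : PTodoub _ _ = tabloid_of @: [set f | is_placement f]).
  rewrite big_imset /=; first by apply: eq_bigl => f; rewrite inE.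
  by move=> f g; rewrite !inE; exact: tabloid_of_inj.
apply/setP => T; apply/idP/imsetP => [/tabloid_of_surj[f fP ->]|[f]].
  by exists f; rewrite ?inE.
by rewrite inE => fP ->; exact: tabloid_of_odoub.
Qed.

Lemma ell2_tabloid_of f : ell2 (tabloid_of f) = \sum_i (f i).2.
Proof.
rewrite /ell2 -sum1dep_card big_mkcond; apply: eq_bigr => i _.
by rewrite ffunE /=; case: (f i).2.
Qed.

End Tabloids.

(** * The expansion *)

(* [P_(d^r)] and [E+_(d^r)].  [psubst 0] is junk; the values at [r = 0] satisfy
   the same recursion and let the empty rows of tensor factor 0 contribute 1. *)
Definition Pblock (d r : nat) : pseries := if r == 0%N then 0 else psubst r (Pd d).
Definition Eblock (d r : nat) : pseries := if r == 0%N then (d == 0%N)%:R else psubst r (Eplusd d).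

Lemma Eblock0 r : Eblock 0 r = 1.
Proof. by rewrite /Eblock; case: posnP => // r0; rewrite Eplusd0 psubst1. Qed.

Lemma Eblock_rec d r : d%:R *: Eblock d r =
  \sum_(1 <= a < d.+1) Pblock a r * Eblock (d - a) r -
  2%:R *: \sum_(1 <= a < d.+1 | (2 * a <= d)%N) Pblock a (2 * r) * Eblock (d - 2 * a) r.
Proof.
rewrite /Eblock /Pblock; case: posnP => [->|r0]; last first.
  by rewrite muln_eq0 /= eqn0Ngt r0 psubst_Eplusd_rec.
rewrite muln0 /= !big1 ?scaler0 ?subrr => [|a _|a _]; rewrite ?mul0r //.
by case: d => [|d]; rewrite ?scale0r ?scaler0.
Qed.

Lemma Posz_sum I (r : seq I) (P : pred I) (F : I -> nat) :
  (\sum_(i <- r | P i) F i)%N%:Z = \sum_(i <- r | P i) (F i)%:Z.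
Proof. exact: (big_morph Posz PoszD (erefl 0)). Qed.

(** * Expansion of E+_sigma into words, grouped by type *)

Section Rows.
Variables (n : nat) (sigma : typ n).

Definition row_mult (j : 'I_n.+1 * 'I_n) : nat := j.1.
Definition row_shape : {ffun 'I_n.+1 * 'I_n -> int} := [ffun j => (row_len sigma j)%:Z].

Local Notation word_letter := (letter ('I_n.+1 * 'I_n)%type n).

Lemma prod_tpart (V : comPzSemiRingType) (F : nat -> V) i : F 0%N = 1 ->
  \prod_(a < n) F (nth 0%N (tpart sigma i) a) = \prod_(d <- tpart sigma i) F d.
Proof.
move=> F0; rewrite [RHS](big_nth 0%N) big_mkord.
rewrite (big_ord_widen _ (fun a => F (nth 0%N (tpart sigma i) a)) (size_tpart_le sigma i)).
rewrite [RHS]big_mkcond; apply: eq_bigr => a _; case: ltnP => // le.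
by rewrite nth_default.
Qed.

(** Positions beyond the last part of a partition, and all those of tensor factor 0, contribute
    [Eblock 0 _ = 1], so the product over blocks extends to all row positions of the encoding. *)
Lemma ptyp_Eplusd_rows : ptyp Eplusd sigma = eprod Eblock row_mult row_shape.
Proof.
rewrite ptypE big_allpairs_dep /eprod.
under [RHS]eq_bigr => j _ do rewrite ffunE /=.
rewrite -(pair_bigA _ (fun (i : 'I_n.+1) (a : 'I_n) => Eblock (nth 0%N (tpart sigma i) a) i)) /=.
under [RHS]eq_bigr => i _ do rewrite (prod_tpart (F := Eblock ^~ i)) ?Eblock0 //.
rewrite big_ord_recl tpart_out // big_nil mul1r.
rewrite -(big_mkord xpredT (fun i => \prod_(d <- tpart sigma i.+1) Eblock d i.+1)).
rewrite -(big_add1 _ _ 0 n.+1 xpredT (fun i => \prod_(d <- tpart sigma i) Eblock d i)).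
rewrite /index_iota subSS subn0 big_seq [RHS]big_seq; apply: eq_bigr => r.
by rewrite mem_iota /Eblock => /andP[/lt0n_neq0/negPf ->].
Qed.

Lemma sum_row_shape : \sum_j (row_mult j)%:Z * row_shape j = n%:Z.
Proof.
have /and3P[_ _ /eqP E] := valP sigma; rewrite -[in RHS]E.
rewrite (eq_bigr (fun j : 'I_n.+1 * 'I_n => (j.1 * nth 0 (tpart sigma j.1) j.2)%N%:Z)) => [|j _]; last first.
  by rewrite ffunE -PoszM.
rewrite -Posz_sum -(pair_bigA _ (fun (i : 'I_n.+1) (a : 'I_n) => (i * nth 0 (tpart sigma i) a)%N)) /=.
congr Posz; rewrite big_ord_recl big1 // add0n.
rewrite big_add1 /= big_mkord; apply: eq_bigr => i _.
rewrite -big_distrr /= sumnE [in RHS](big_nth 0%N) big_mkord; congr (_ * _)%N.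
rewrite [RHS](big_ord_widen _ (fun a => nth 0%N (tpart sigma i.+1) a) (size_tpart_le sigma i.+1)).
rewrite [RHS]big_mkcond; apply: eq_bigr => a _; case: ltnP => // le.
by rewrite nth_default.
Qed.

Definition block_word s (t : s.-tuple word_letter) : s.-tuple (nat * nat) :=
  [tuple of map (letter_block row_mult) t].

(** Multiplicity of the row times length of the object is d r in both cases: a doublebrick doubles
    the length and sits in the factor of half the multiplicity. *)
Lemma block_word_weight s (t : s.-tuple word_letter) :
  \sum_(x <- t) letter_vec x = row_shape -> (\sum_(b <- block_word t) b.1 * b.2)%N = n.
Proof.
move=> tD; apply/eqP; rewrite -eqz_nat -sum_row_shape -tD big_map; apply/eqP.
under [RHS]eq_bigr do rewrite sum_ffunE mulr_sumr.
rewrite exchange_big /= Posz_sum; apply: eq_bigr => x _.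
rewrite (bigD1 x.1.1) //= ffunE eqxx big1 ?addr0 => [|j /negPf jx]; last first.
  by rewrite ffunE jx mulr0.
rewrite -PoszM /letter_len /row_mult; congr Posz.
by rewrite /= mulnA mulnC (mulnC x.2.+1).
Qed.

Definition word_sign s (t : s.-tuple word_letter) : rat := \prod_(x <- t) (-1) ^+ x.1.2.

Lemma word_weightE s (t : s.-tuple word_letter) :
  all (fun b => 0 < b.2)%N (block_word t) ->
  \prod_(x <- t) letter_weight Pblock row_mult x =
  (word_sign t / (\prod_(b <- block_word t) b.1)%N%:R) *: Pprod (block_word t).
Proof.
rewrite /word_sign /Pprod !big_map; case: t => l /= _; elim: l => [|x l IH] /=.
  by rewrite !big_nil invr1 mulr1 scale1r.
case/andP=> x0 l0; rewrite !big_cons IH // /letter_weight /Pblock.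
rewrite eqn0Ngt x0 -scalerAl -scalerAr scalerA; congr (_ *: _).
by rewrite natrM invfM mulrACA.
Qed.

(** A block of multiplicity 0 comes from a letter in tensor factor 0, where [Pblock] vanishes. *)
Lemma word_weight0 s (t : s.-tuple word_letter) :
  ~~ all (fun b => 0 < b.2)%N (block_word t) ->
  \prod_(x <- t) letter_weight Pblock row_mult x = 0.
Proof.
rewrite -has_predC => /hasP[b /mapP[x xt ->]] /=; rewrite -eqn0Ngt => /eqP b0.
rewrite (big_rem x) //= /letter_weight /Pblock.
by move: b0; rewrite /letter_block /= => ->; rewrite scaler0 mul0r.
Qed.

Lemma block_word_typ s (t : s.-tuple word_letter) :
  \sum_(x <- t) letter_vec x = row_shape -> all (fun b => 0 < b.2)%N (block_word t) ->
  exists tau : typ n, perm_eq (blocks tau) (block_word t).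
Proof.
move=> tD pos; apply: exists_typ; last exact: block_word_weight.
apply/allP => b bt; rewrite (allP pos _ bt) andbT.
by case/mapP: bt => x _ ->.
Qed.

Lemma size_blocks (tau : typ n) : (size (blocks tau) <= n)%N.
Proof.
rewrite -[leqRHS](sum_blocks tau) -sum1_size big_seq [leqRHS]big_seq.
by apply: leq_sum => b /blocks_gt0[b1 b2]; rewrite muln_gt0 b1.
Qed.

Definition word_sum s (L : s.-tuple (nat * nat)) : rat :=
  \sum_(t : s.-tuple word_letter | (\sum_(x <- t) letter_vec x == row_shape) && (block_word t == L))
    word_sign t.

(** Permuting the letters of a word changes neither the sum of their vectors nor the sign, and
    permutes the block sequence accordingly. *)
Lemma word_sum_perm s (L L' : s.-tuple (nat * nat)) : perm_eq L L' -> word_sum L = word_sum L'.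
Proof.
case/tuple_permP => pi /val_inj ->; rewrite /word_sum.
pose h (t : s.-tuple word_letter) := [tuple tnth t (pi i) | i < s].
have perm_h t : perm_eq (h t) t by apply/tuple_permP; exists pi.
have map_h t : block_word (h t) = [tuple tnth (block_word t) (pi i) | i < s].
  by apply: eq_from_tnth => i; rewrite /block_word tnth_map !tnth_mktuple tnth_map.
have h_inj : injective h.
  move=> t t' E; apply: eq_from_tnth => i.
  have := congr1 (fun u => tnth u ((pi^-1)%g i)) E.
  by rewrite !tnth_mktuple permKV.
rewrite (reindex_inj h_inj) /=; apply: eq_big => [t|t _].
  rewrite (perm_big _ (perm_h t)) map_h; congr (_ && _).
  apply/eqP/eqP => [E|-> //]; apply: eq_from_tnth => i.
  have := congr1 (fun u => tnth u ((pi^-1)%g i)) E.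
  by rewrite !tnth_mktuple permKV.
by rewrite /word_sign (perm_big _ (perm_h t)).
Qed.

(** The words are sorted by the order in which they spell the blocks; by [word_sum_perm] every order
    contributes the same. *)
Lemma word_sum_permutations s (L : s.-tuple (nat * nat)) :
  \sum_(t : s.-tuple word_letter |
      (\sum_(x <- t) letter_vec x == row_shape) && perm_eq L (block_word t)) word_sign t =
  (size (permutations L))%:R * word_sum L.
Proof.
have E l : l \in permutations L ->
  \sum_(t : s.-tuple word_letter |
    (\sum_(x <- t) letter_vec x == row_shape) && (block_word t == l :> seq _)) word_sign t = word_sum L.
  rewrite mem_permutations => lL; have sl : size l == s by rewrite (perm_size lL) size_tuple.
  by rewrite (word_sum_perm (L' := Tuple sl)) // perm_sym.
rewrite -sum1_size natr_sum mulr_suml.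
rewrite (eq_big_seq (fun l => \sum_(t : s.-tuple word_letter | \sum_(x <- t) letter_vec x == row_shape)
    if block_word t == l :> seq _ then word_sign t else 0)); last first.
  by move=> l /E <-; rewrite mul1r -big_mkcondr.
rewrite exchange_big /= big_mkcondr /=; apply: eq_bigr => t _.
rewrite perm_sym -mem_permutations; case: ifPn => [tL|tL].
  rewrite (bigD1_seq _ tL) ?permutations_uniq //= eqxx big1 ?addr0 // => l /negPf.
  by rewrite eq_sym => ->.
by rewrite big_seq big1 // => l lL; case: eqP => // tl; rewrite tl lL in tL.
Qed.

(** Prescribing the blocks fixes the degree in each letter; what remains of the word is, for every
    label, a row and a choice between brick and doublebrick. *)
Lemma word_sum_placement (tau : typ n) :
  word_sum (in_tuple (blocks tau)) =
  \sum_(f : placement tau | is_placement sigma f) (-1) ^+ (\sum_i (f i).2)%N.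
Proof.
have lt (i : label tau) : ((block_at i).1.-1 < n)%N.
  have [d0 r0] := block_at_gt0 i; rewrite prednK //.
  have : block_at i \in blocks tau by rewrite mem_nth.
  case: (block_at i) d0 => d r _ /=; rewrite mem_blocks => /(nth_index 0%N) <-.
  exact: nth_tpart_le.
pose h (f : placement tau) : (size (blocks tau)).-tuple word_letter :=
  [tuple (f i, Ordinal (lt i)) | i < size (blocks tau)].
pose h' (t : (size (blocks tau)).-tuple word_letter) : placement tau :=
  [ffun i => (tnth t i).1].
have blockE t i : block_word t = in_tuple (blocks tau) -> letter_block row_mult (tnth t i) = block_at i.
  move=> E; rewrite -(tnth_map (letter_block row_mult)) -/(block_word t) E.
  by rewrite (tnth_nth (0, 0)%N).
(* [h' (h f) = f] always holds, but [h (h' t) = t] is only available when [t] spells the blocks of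
   [tau]. *)
rewrite /word_sum (reindex_onto h h') => [|t /andP[_ /eqP E]]; last first.
  apply: eq_from_tnth => i; rewrite tnth_mktuple ffunE [RHS]surjective_pairing; congr pair.
  by apply: val_inj; rewrite /= -(blockE t i E).
have h'h f : h' (h f) = f by apply/ffunP => i; rewrite ffunE tnth_mktuple.
apply: eq_big => [f|f _].
  rewrite h'h eqxx andbT andbC; congr (_ && _).
    apply/eqP/forallP => [E i|E].
      by rewrite -(blockE _ _ E) tnth_mktuple.
    apply: eq_from_tnth => i; rewrite tnth_map tnth_mktuple (tnth_nth (0, 0)%N) /=.
    rewrite -/(block_at i) [RHS]surjective_pairing (eqP (E i)) /letter_block /= prednK //.
    by case: (block_at_gt0 i).
  have colE j : (\sum_(x <- h f) letter_vec x) j = (prefix_len f j (size (blocks tau)))%:Z.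
    rewrite sum_ffunE big_tuple /prefix_len Posz_sum [RHS]big_mkcond; apply: eq_bigr => i _.
    rewrite tnth_mktuple ffunE ltn_ord /= eq_sym; case: eqP => // _.
    rewrite /letter_len /placed_len /= prednK //.
    by case: (block_at_gt0 i).
  apply/eqP/forallP => [E j|E].
    by rewrite -eqz_nat -colE E ffunE.
  by apply/ffunP => j; rewrite colE ffunE (eqP (E j)).
rewrite /word_sign big_tuple expr_sum; apply: eq_bigr => i _.
by rewrite tnth_mktuple.
Qed.

(** A word of nonzero weight that fills the rows belongs to exactly one type, by [block_word_typ]
    and [blocks_inj]. *)
Lemma words_by_type s :
  words (letter_vec (N := n)) (letter_weight Pblock row_mult) s row_shape =
  \sum_(tau : typ n) ((\sum_(t : s.-tuple word_letter |
      (\sum_(x <- t) letter_vec x == row_shape) && perm_eq (blocks tau) (block_word t)) word_sign t) /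
    (\prod_(b <- blocks tau) b.1)%N%:R) *: ptyp Pd tau.
Proof.
have split (t : s.-tuple word_letter) : \sum_(x <- t) letter_vec x == row_shape ->
  \prod_(x <- t) letter_weight Pblock row_mult x = \sum_(tau : typ n)
    if perm_eq (blocks tau) (block_word t) then
      (word_sign t / (\prod_(b <- blocks tau) b.1)%N%:R) *: (ptyp Pd tau : pseries) else 0.
  move=> /eqP tD; have [pos|npos] := boolP (all (fun b => 0 < b.2)%N (block_word t)).
    have [tau tauP] := block_word_typ tD pos.
    rewrite (bigD1 tau) //= tauP [X in _ + X]big1 ?addr0 => [|tau' ne]; last first.
      case: ifP => // tauP'; case/eqP: ne; apply: blocks_inj.
      by rewrite (permPl tauP') perm_sym.
    by rewrite word_weightE // ptypE /Pprod -!(perm_big _ tauP).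
  rewrite word_weight0 //; apply/esym/big1 => tau _; case: ifP => // tauP; case/negP: npos.
  by rewrite -(perm_all _ tauP); apply/allP => b /blocks_gt0[].
rewrite words_tupleE (eq_bigr _ split) exchange_big /=; apply: eq_bigr => tau _.
by rewrite mulr_suml scaler_suml big_mkcondr.
Qed.

(** The multinomial formula for the orders of the blocks; it turns the factors 1/s! and 1/d of the
    words into 1/z_tau. *)
Lemma ztensor_permutations (tau : typ n) :
  ((size (blocks tau))`! * \prod_(b <- blocks tau) b.1 =
   ztensor tau * size (permutations (blocks tau)))%N.
Proof.
have [uU sU ->] := ztensorE tau.
by rewrite -(size_permutations_count uU sU) -mulnA mulnC; congr (_ * _)%N; exact: mulnC.
Qed.

Lemma ptyp_Eplusd_expansion :
  ptyp Eplusd sigma = \sum_(tau : typ n)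
    (word_sum (in_tuple (blocks tau)) / (ztensor tau)%:R) *: ptyp Pd tau.
Proof.
(* [M] has to exceed the total row length, for [eprod_words], and the number of blocks of any type
   of [n], so that the word length [size (blocks tau)] occurs in the sum. *)
pose M := (n + \sum_j row_len sigma j).+1.
rewrite ptyp_Eplusd_rows (@eprod_words _ _ _ _ _ n Eblock0 Eblock_rec M); first last.
- under eq_bigr do rewrite ffunE.
  by rewrite -Posz_sum ltz_nat ltnS leq_addl.
- by move=> j; rewrite ffunE lez_nat row_len_le.
under eq_bigr do rewrite words_by_type scaler_sumr.
rewrite exchange_big /=; apply: eq_bigr => tau _.
under eq_bigr do rewrite scalerA.
rewrite -scaler_suml; congr (_ *: _).
have sM : (size (blocks tau) < M)%N by rewrite ltnS (leq_trans (size_blocks tau)) ?leq_addr.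
rewrite (bigD1 (Ordinal sM)) //= [X in _ + X]big1 ?addr0 => [|s sne]; last first.
  rewrite big_pred0 ?mul0r ?mulr0 // => t; apply/negP => /andP[_ /perm_size E].
  by case/eqP: sne; apply: val_inj; rewrite /= E size_tuple.
rewrite (word_sum_permutations (in_tuple (blocks tau))).
have := congr1 (fun k => k%:R : rat) (ztensor_permutations tau); rewrite !natrM => E.
have [uU sU zE] := ztensorE tau.
have z0 : (ztensor tau)%:R != 0 :> rat.
  rewrite pnatr_eq0 zE muln_eq0 negb_or -!lt0n; apply/andP; split.
    by rewrite big_seq; apply: prodn_cond_gt0 => b /blocks_gt0[].
  by apply: prodn_gt0 => b; rewrite fact_gt0.
have p0 : (\prod_(b <- blocks tau) b.1)%N%:R != 0 :> rat.
  by apply: contraNneq z0 => p0; rewrite zE natrM p0 mul0r.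
have f0 : (size (blocks tau))`!%:R != 0 :> rat by rewrite pnatr_eq0 -lt0n fact_gt0.
have -> : (size (permutations (blocks tau)))%:R =
    (size (blocks tau))`!%:R * (\prod_(b <- blocks tau) b.1)%N%:R / (ztensor tau)%:R :> rat.
  by rewrite E mulrAC divff // mul1r.
by rewrite /=; field; rewrite z0 p0 f0.
Qed.

End Rows.

Theorem theorem47 (n : nat) (sigma tau : typ n) :
  (exists c : typ n -> rat, expands (ptyp Eplusd sigma) Pd c) /\
  (forall c : typ n -> rat, expands (ptyp Eplusd sigma) Pd c ->
     c tau = \sum_(T in PTodoub sigma tau) (-1) ^+ ell2 T / (ztensor tau)%:R).
Proof.
pose c0 (rho : typ n) := word_sum sigma (in_tuple (blocks rho)) / (ztensor rho)%:R.
have c0P : expands (ptyp Eplusd sigma) Pd c0.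
  by move=> m; rewrite ptyp_Eplusd_expansion coef_sump.
split; first by exists c0.
move=> c cP; have -> : c tau = c0 tau.
  apply/eqP; rewrite -subr_eq0; apply/eqP; apply: (ptyp_Pd_free (c := fun rho => c rho - c0 rho)) => m.
  by under eq_bigr do rewrite mulrBl; rewrite sumrB -cP -c0P subrr.
rewrite -mulr_suml sum_PTodoub /c0 word_sum_placement; congr (_ / _).
by apply: eq_bigr => f _; rewrite ell2_tabloid_of.
Qed.
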